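(* Let $\mathbf{t}(\omega,P)$ be a universal uniform test on $\Omega\times\mathcal{M}(\Omega)$. Then $$\mathbf{t}(\omega,P)\doteq\sum_{x\sqsubseteq\omega}\frac{\mathbf{m}(x\mid P)}{P(x)},$$ i.e. the two sides are within bounded multiplicative constants of each other for all $\omega\in\Omega$ and all $P\in\mathcal{M}(\Omega)$ (a term with $P(x)=0$ is taken to be $+\infty$).
   Context: $\Omega=\{0,1\}^{\mathbb{N}}$, $x\sqsubseteq\omega$ means the word $x$ is a prefix of $\omega$, $P(x)=P(x\Omega)$. $\mathcal{M}(\Omega)$ is the space of probability measures on $\Omega$ with basic sets given by finitely many conditions $u<P(y)<v$ ($u,v$ rational). Basic open sets of $\Omega\times\mathcal{M}(\Omega)$ are $x\Omega\times\beta$; a function into $[0,\infty]$ is lower semicomputable if for each rational $r$ the set where it exceeds $r$ is a union of an enumerable family of basic open sets, uniformly in $r$ (for functions on $\{0,1\}^*\times\mathcal{M}(\Omega)$ the same, with basic sets $\{x\}\times\beta$). A uniform test is a lower semicomputable $t(\omega,P)\ge0$ with $\int t(\omega,P)\,dP(\omega)\le1$ for all $P$; universal = maximal up to a multiplicative constant. A uniform lower semicomputable semimeasure is a lower semicomputable $m:\{0,1\}^*\times\mathcal{M}(\Omega)\to[0,\infty]$ with $\sum_xm(x,P)\le1$ for every $P$; $\mathbf{m}(x\mid P)$ denotes a maximal one up to a multiplicative constant (it exists). *)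

(* Defs.v *)
From Stdlib Require List.
From HB Require Import structures.
From mathcomp Require Import all_boot all_order all_algebra.
From mathcomp Require Import all_classical all_reals all_analysis.
Import Order.TTheory GRing.Theory Num.Theory.

Set Implicit Arguments.
Unset Strict Implicit.
Unset Printing Implicit Defensive.

Local Open Scope classical_set_scope.
Local Open Scope ring_scope.

(* Computable total functions on finite data: the least class of functions
   between the types built from nat and bool by products and lists that contains
   the constructors and projections and is closed under composition, definition
   by cases, primitive recursion on nat, recursion on lists, and minimization of
   regular predicates. On nat these are exactly the total recursive functions;
   working with structured data avoids a choice of Goedel numbering. *)
Inductive dtype : Type :=
  | DNat | DBool | DProd of dtype & dtype | DSeq of dtype.

Fixpoint dval (A : dtype) : Type :=
  match A with
  | DNat => nat
  | DBool => bool
  | DProd A1 A2 => dval A1 * dval A2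
  | DSeq A1 => seq (dval A1)
  end.

Coercion dval : dtype >-> Sortclass.

Inductive computable : forall A B : dtype, (A -> B) -> Prop :=
  | computable_ext (A B : dtype) (f g : A -> B) :
      f =1 g -> computable f -> computable g
  | computable_id (A : dtype) : @computable A A (fun a => a)
  | computable_comp (A B C : dtype) (g : B -> C) (f : A -> B) :
      computable g -> computable f -> @computable A C (fun a => g (f a))
  | computable_pair (A B C : dtype) (f : A -> B) (g : A -> C) :
      computable f -> computable g ->
      @computable A (DProd B C) (fun a => (f a, g a))
  | computable_fst (A B : dtype) : @computable (DProd A B) A (fun p => p.1)
  | computable_snd (A B : dtype) : @computable (DProd A B) B (fun p => p.2)
  | computable_zero (A : dtype) : @computable A DNat (fun=> 0%N)
  | computable_succ : @computable DNat DNat succn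
  | computable_natrec (A B : dtype) (f : A -> B)
      (g : DProd A (DProd DNat B) -> B) :
      computable f -> computable g ->
      @computable (DProd A DNat) B
        (fun p => nat_rect (fun=> dval B) (f p.1)
                    (fun n b => g (p.1, (n, b))) p.2)
  | computable_bool (A : dtype) (b : bool) : @computable A DBool (fun=> b)
  | computable_if (A B : dtype) (c : A -> DBool) (f g : A -> B) :
      computable c -> computable f -> computable g ->
      @computable A B (fun a => if c a then f a else g a)
  | computable_nil (A B : dtype) : @computable A (DSeq B) (fun=> [::])
  | computable_cons (A : dtype) :
      @computable (DProd A (DSeq A)) (DSeq A) (fun p => p.1 :: p.2)
  | computable_foldr (A B E : dtype) (f : A -> B)
      (g : DProd A (DProd E B) -> B) :
      computable f -> computable g ->
      @computable (DProd A (DSeq E)) B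
        (fun p => foldr (fun (e : E) (b : B) => g (p.1, (e, b))) (f p.1) p.2)
  | computable_mu (A : dtype) (c : DProd A DNat -> DBool) (f : A -> DNat) :
      computable c ->
      (forall a : A, c (a, f a)) ->
      (forall (a : A) (n : nat), (n < f a)%N -> ~~ c (a, n)) ->
      computable f.

Definition enumerable (A : dtype) (S : set A) : Prop :=
  S = set0 \/ exists2 e : DNat -> A, computable e & S = range e.

Definition word : Type := seq bool.

Definition prefix_of (x : word) (w : nat -> bool) : Prop :=
  forall i : nat, (i < size x)%N -> w i = nth false x i.

Definition cylinder (x : word) : set (nat -> bool) := [set w | prefix_of x w].

(* Infinite binary sequences with the Borel sigma-algebra, generated by the
   cylinders. *)
Definition Omega := g_sigma_algebraType (range cylinder).

Definition DWord : dtype := DSeq DBool.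

(* Names of rationals: ((a, b), c) names (a - b) / (c + 1). *)
Definition DRat : dtype := DProd (DProd DNat DNat) DNat.

Definition rat_val (R : realType) (q : DRat) : R :=
  (q.1.1%:R - q.1.2%:R) / q.2.+1%:R.

(* ((u, v), y) stands for the condition u < P(y) < v. *)
Definition DCond : dtype := DProd (DProd DRat DRat) DWord.

Definition DBasic : dtype := DProd DWord (DSeq DCond).

Section UniformTests.
Variable R : realType.
Local Open Scope ereal_scope.

Definition Measures := probability Omega R.

Definition mass (P : Measures) (x : word) : \bar R := P (cylinder x).

Definition cond_holds (P : Measures) (k : DCond) : Prop :=
  (rat_val R k.1.1)%:E < mass P k.2 /\ mass P k.2 < (rat_val R k.1.2)%:E.

Definition basic_measures (s : DSeq DCond) : set Measures :=
  [set P | forall k : DCond, List.In k s -> cond_holds P k].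

(* N x is the basic subset of T named by the word x. The set of pairs (q, b)
   being enumerable expresses uniformity in the rational named by q. *)
Definition lower_semicomputable (T : Type) (N : word -> set T)
    (f : T -> Measures -> \bar R) : Prop :=
  exists2 S : set (DProd DRat DBasic), enumerable S &
    forall q : DRat,
      [set z : T * Measures | (rat_val R q)%:E < f z.1 z.2] =
      \bigcup_(b in [set b : DBasic | S (q, b)])
        (N b.1 `*` basic_measures b.2).

Definition uniform_test (t : Omega -> Measures -> \bar R) : Prop :=
  [/\ lower_semicomputable cylinder t,
      forall w P, 0 <= t w P &
      forall P : Measures, \int[P]_w t w P <= 1].

Definition universal_uniform_test (t : Omega -> Measures -> \bar R) : Prop :=
  uniform_test t /\
  forall t', uniform_test t' ->
    exists2 c : R, (0 < c)%R & forall w P, t' w P <= c%:E * t w P.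

Definition uniform_semimeasure (m : word -> Measures -> \bar R) : Prop :=
  [/\ lower_semicomputable (fun x => [set x]) m,
      forall x P, 0 <= m x P &
      forall P : Measures, \esum_(x in [set: word]) m x P <= 1].

Definition maximal_uniform_semimeasure (m : word -> Measures -> \bar R) : Prop :=
  uniform_semimeasure m /\
  forall m', uniform_semimeasure m' ->
    exists2 c : R, (0 < c)%R & forall x P, m' x P <= c%:E * m x P.

Definition mass_ratio (m : word -> Measures -> \bar R) (P : Measures) (x : word) :
    \bar R :=
  if mass P x == 0 then +oo else m x P / mass P x.

Definition prefix_sum (m : word -> Measures -> \bar R) (w : Omega)
    (P : Measures) : \bar R :=
  \esum_(x in [set x : word | prefix_of x w]) mass_ratio m P x.

End UniformTests.

(* Main.v *)
From Stdlib Require List.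
Require Import Defs.
From HB Require Import structures.
From mathcomp Require Import all_boot all_order all_algebra.
From mathcomp Require Import all_classical all_reals all_analysis.
From mathcomp Require Import measurable_realfun ring lra zify.
Import Order.TTheory GRing.Theory Num.Theory.
Local Open Scope ring_scope.

Set Implicit Arguments.
Unset Strict Implicit.
Unset Printing Implicit Defensive.

Local Open Scope classical_set_scope.

(** For nonnegative [g], the integral over [w] of the sum of [g x] over the prefixes
    [x] of [w] is the sum over all words of [g x * P(x)]. Hence the prefix sum of a
    semimeasure [m] has integral at most [1]. It is lower semicomputable because a
    maximal [m] is everywhere positive: near a measure with [P(x) = 0], a positive
    lower bound on [m x P] and a small upper bound on [P(x)] force the ratio to be
    large. Universality of [t] gives the first inequality.

    Conversely, a uniform test [t] is the supremum of an increasing sequence of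
    functions [stage k w P] that depend only on the first [k] bits of [w] and are
    continuous and computable in [P], since they are maxima and minima of affine
    functions of finitely many masses. Setting [f x P] to be the increment
    [stage k - stage k.-1] for [k = size x], the sum of [f x P] over the prefixes of
    [w] telescopes to [t w P], and [f x P * P(x)] is a uniform semimeasure whose
    total mass is the integral of [t]. Maximality of [m] gives the second
    inequality. *)

(** * Computable functions and semidecidable sets *)

Lemma computable_comp2 (A B C D : dtype) (g : DProd B C -> D)
    (f : A -> B) (h : A -> C) :
  computable g -> computable f -> computable h ->
  @computable A D (fun a => g (f a, h a)).
Proof. by move=> cg cf ch; apply: (computable_comp cg); apply: computable_pair. Qed.

Lemma computable_pr1 (A B C : dtype) (f : A -> DProd B C) :
  computable f -> @computable A B (fun a => (f a).1).
Proof. by move=> cf; apply: (computable_comp (@computable_fst B C)). Qed.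

Lemma computable_pr2 (A B C : dtype) (f : A -> DProd B C) :
  computable f -> @computable A C (fun a => (f a).2).
Proof. by move=> cf; apply: (computable_comp (@computable_snd B C)). Qed.

(* Reduction of [dval] leaves projections whose type arguments are unfolded, so that
   unification cannot recover the [dtype]s; these tactics enumerate them instead. *)
Ltac projection_from c :=
  first [ exact c
        | let T := type of c in
          match T with @computable ?A ?D _ =>
            let D' := eval hnf in D in
            match D' with DProd ?B ?C =>
              first [ projection_from (@computable_pr1 A B C _ c)
                    | projection_from (@computable_pr2 A B C _ c) ]
            end
          end ].

Ltac projection :=
  match goal with |- @computable ?A _ _ =>
    projection_from (computable_id A)
  end.

Lemma computable_nat_rect (A B : dtype) (n : A -> DNat) (f : A -> B)
    (g : DProd A (DProd DNat B) -> B) :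
  computable n -> computable f -> computable g ->
  @computable A B (fun a => nat_rect (fun=> dval B) (f a)
                              (fun k b => g (a, (k, b))) (n a)).
Proof.
move=> cn cf cg.
exact: (computable_comp2 (computable_natrec cf cg) (@computable_id A) cn).
Qed.

Lemma computable_foldr_seq (A B E : dtype) (l : A -> DSeq E) (f : A -> B)
    (g : DProd A (DProd E B) -> B) :
  computable l -> computable f -> computable g ->
  @computable A B (fun a => foldr (fun (e : E) (b : B) => g (a, (e, b)))
                              (f a) (l a)).
Proof.
move=> cl cf cg.
exact: (computable_comp2 (computable_foldr cf cg) (@computable_id A) cl).
Qed.

Lemma computable_S (A : dtype) (f : A -> DNat) :
  computable f -> @computable A DNat (fun a => (f a).+1).
Proof. by move=> cf; apply: (computable_comp computable_succ). Qed.

Lemma computable_nat (A : dtype) (n : nat) : @computable A DNat (fun=> n).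
Proof.
elim: n => [|n IH]; first exact: computable_zero.
exact: (computable_S IH).
Qed.

Lemma computable_pred (A : dtype) (f : A -> DNat) :
  computable f -> @computable A DNat (fun a => (f a).-1).
Proof.
move=> cf.
apply: (computable_ext _ (computable_nat_rect (B := DNat) (g := fun p => p.2.1) cf
  (computable_zero A) _)); first by move=> a; case: (f a).
projection.
Qed.

Lemma computable_addn (A : dtype) (f g : A -> DNat) :
  computable f -> computable g -> @computable A DNat (fun a => f a + g a)%N.
Proof.
move=> cf cg.
apply: (computable_ext _ (computable_nat_rect (B := DNat) (g := fun p => p.2.2.+1) cf cg _)).
  by move=> a; elim: (f a) => //= n ->; rewrite addSn.
by apply/computable_S; projection.
Qed.

Lemma computable_muln (A : dtype) (f g : A -> DNat) :
  computable f -> computable g -> @computable A DNat (fun a => f a * g a)%N.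
Proof.
move=> cf cg.
apply: (computable_ext _ (computable_nat_rect (B := DNat) (g := fun p => g p.1 + p.2.2)%N cf
  (computable_zero A) _)).
  by move=> a; elim: (f a) => //= n ->; rewrite mulSn.
apply: computable_addn; last projection.
by apply: (computable_comp cg); projection.
Qed.

Lemma computable_subn (A : dtype) (f g : A -> DNat) :
  computable f -> computable g -> @computable A DNat (fun a => f a - g a)%N.
Proof.
move=> cf cg.
apply: (computable_ext _ (computable_nat_rect (B := DNat) (g := fun p => p.2.2.-1)%N cg cf _)).
  by move=> a; elim: (g a) => [|n /= ->]; rewrite ?subn0 ?subnS.
by apply/computable_pred; projection.
Qed.

Lemma computable_leq (A : dtype) (f g : A -> DNat) :
  computable f -> computable g -> @computable A DBool (fun a => f a <= g a)%N.
Proof.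
move=> cf cg.
apply: (computable_ext _ (computable_nat_rect (B := DBool) (g := fun=> false)%N
  (computable_subn cf cg) (computable_bool A true) _)).
  by move=> a; rewrite /leq; case: (f a - g a)%N.
exact: computable_bool.
Qed.

Lemma computable_andb (A : dtype) (f g : A -> DBool) :
  computable f -> computable g -> @computable A DBool (fun a => f a && g a).
Proof.
move=> cf cg; exact: (computable_if cf cg (computable_bool A false)).
Qed.

Lemma computable_orb (A : dtype) (f g : A -> DBool) :
  computable f -> computable g -> @computable A DBool (fun a => f a || g a).
Proof.
move=> cf cg; exact: (computable_if cf (computable_bool A true) cg).
Qed.

Lemma computable_negb (A : dtype) (f : A -> DBool) :
  computable f -> @computable A DBool (fun a => ~~ f a).
Proof.
by move=> cf; apply: (computable_if cf); exact: computable_bool.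
Qed.

Lemma computable_all_iota (A : dtype) (n : A -> DNat) (c : DProd A DNat -> DBool) :
  computable n -> computable c ->
  @computable A DBool (fun a => all (fun i => c (a, i)) (iota 0 (n a))).
Proof.
move=> cn cc.
apply: (computable_ext _ (computable_nat_rect
  (B := DBool) (g := fun p => c (p.1, p.2.1) && p.2.2) cn (computable_bool A true) _)).
  move=> a; elim: (n a) => // k IH.
  by rewrite -[in RHS]addn1 iotaD all_cat -IH /= andbT andbC.
apply: computable_andb; last projection.
apply: (computable_comp2 cc); first projection.
projection.
Qed.

Lemma computable_has_iota (A : dtype) (n : A -> DNat) (c : DProd A DNat -> DBool) :
  computable n -> computable c ->
  @computable A DBool (fun a => has (fun i => c (a, i)) (iota 0 (n a))).
Proof.
move=> cn cc.
apply: (computable_ext _ (computable_negb (computable_all_iota cn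
  (computable_negb cc)))) => a.
by rewrite -has_predC; apply: eq_has => i /=; rewrite negbK.
Qed.

(** * Computable list operations and decidable equality *)

Fixpoint dval_default (A : dtype) : A :=
  match A with
  | DNat => 0%N
  | DBool => false
  | DProd A1 A2 => (dval_default A1, dval_default A2)
  | DSeq A1 => [::]
  end.

Lemma computable_default (A B : dtype) :
  @computable A B (fun=> dval_default B).
Proof.
elim: B => [||B1 IH1 B2 IH2|B IH].
- exact: computable_zero.
- exact: computable_bool.
- exact: computable_pair.
- exact: computable_nil.
Qed.

Lemma computable_cons_seq (A B : dtype) (f : A -> B) (g : A -> DSeq B) :
  computable f -> computable g -> @computable A (DSeq B) (fun a => f a :: g a).
Proof. exact: (computable_comp2 (computable_cons B)). Qed.

(** The step of a fold sees the folded value of the tail but not the tail itself, so the fold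
    carries the pair of the tail and the whole list. *)
Lemma computable_behead (A B : dtype) (f : A -> DSeq B) :
  computable f -> @computable A (DSeq B) (fun a => behead (f a)).
Proof.
move=> cf.
pose g (p : DProd A (DProd B (DProd (DSeq B) (DSeq B)))) :
  DProd (DSeq B) (DSeq B) := (p.2.2.2, p.2.1 :: p.2.2.2).
have cg : computable g.
  have c3 : computable (fun p : DProd A (DProd B (DProd (DSeq B) (DSeq B))) =>
      p.2.2.2 : DSeq B).
    projection.
  apply: computable_pair => //; apply: computable_cons_seq => //.
  projection.
apply: (computable_ext _ (computable_pr1 (computable_foldr_seq cf
  (computable_default A (DProd (DSeq B) (DSeq B))) cg))) => a /=.
set h := foldr _ _.
suff -> : h (f a) = (behead (f a), f a) by [].
by rewrite /h; elim: (f a) => //= x s ->.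
Qed.

Lemma computable_head (A B : dtype) (f : A -> DSeq B) :
  computable f -> @computable A B (fun a => head (dval_default B) (f a)).
Proof.
move=> cf.
apply: (computable_ext _ (computable_foldr_seq (B := B) (g := fun p => p.2.1) cf
  (computable_default A B) _)); first by move=> a; case: (f a).
projection.
Qed.

Lemma computable_nth (A B : dtype) (f : A -> DSeq B) (n : A -> DNat) :
  computable f -> computable n ->
  @computable A B (fun a => nth (dval_default B) (f a) (n a)).
Proof.
move=> cf cn.
apply: (computable_ext _ (computable_head (computable_nat_rect
  (B := DSeq B) (g := fun p => behead p.2.2) cn cf _))).
  move=> a /=; rewrite -nth0.
  set h := nat_rect _ _ _.
  have -> : h (n a) = drop (n a) (f a).
    rewrite /h; elim: (n a) => [|k /= ->]; first by rewrite drop0.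
    by rewrite -drop1 drop_drop add1n.
  by rewrite nth_drop addn0.
by apply/computable_behead; projection.
Qed.

Lemma computable_size (A B : dtype) (f : A -> DSeq B) :
  computable f -> @computable A DNat (fun a => size (f a)).
Proof.
move=> cf.
apply: (computable_ext _ (computable_foldr_seq (B := DNat) (g := fun p => p.2.2.+1) cf
  (computable_zero A) _)); first by move=> a; elim: (f a) => //= x s ->.
by apply/computable_S; projection.
Qed.

Lemma computable_cat (A B : dtype) (f g : A -> DSeq B) :
  computable f -> computable g -> @computable A (DSeq B) (fun a => f a ++ g a).
Proof.
move=> cf cg.
apply: (computable_ext _ (computable_foldr_seq (B := DSeq B) (E := B)
  (g := fun p => p.2.1 :: p.2.2)
  cf cg _)); first by move=> a; elim: (f a) => //= x s ->.
by apply: (computable_comp (computable_cons B)); projection.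
Qed.

Lemma computable_flatten (A B : dtype) (f : A -> DSeq (DSeq B)) :
  computable f -> @computable A (DSeq B) (fun a => flatten (f a)).
Proof.
move=> cf.
apply: (computable_ext _ (computable_foldr_seq (B := DSeq B) (E := DSeq B)
  (g := fun p => p.2.1 ++ p.2.2)
  cf (computable_nil A B) _)); first by [].
by apply: computable_cat; [projection
                          |projection].
Qed.

Lemma computable_mkseq (A B : dtype) (n : A -> DNat) (g : DProd A DNat -> B) :
  computable n -> computable g ->
  @computable A (DSeq B) (fun a => mkseq (fun i => g (a, i)) (n a)).
Proof.
move=> cn cg.
apply: (computable_ext _ (computable_nat_rect
  (B := DSeq B) (g := fun p => p.2.2 ++ [:: g (p.1, p.2.1)]) cn (computable_nil A B) _)).
  move=> a; elim: (n a) => // k /= ->.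
  by rewrite mkseqS cats1.
apply: computable_cat; first projection.
apply: computable_cons_seq; last exact: computable_nil.
apply: (computable_comp2 cg); first projection.
projection.
Qed.

(** By induction on the type. Two lists are equal when their sizes agree and their entries agree at
    every position below that size, a bounded quantifier. *)
Lemma computable_eq (A : dtype) : exists2 c : DProd A A -> DBool, computable c &
  forall a b, c (a, b) <-> a = b.
Proof.
elim: A => [||A [c cc cP] B [d cd dP]|A [c cc cP]].
- exists (fun p => (p.1 <= p.2) && (p.2 <= p.1))%N.
    by apply: computable_andb; apply: computable_leq;
      solve [projection|projection].
  by move=> a b; rewrite -eqn_leq; split=> [/eqP|->].
- exists (fun p : DProd DBool DBool => if p.1 then p.2 else ~~ p.2).
    apply: (computable_if (computable_fst DBool DBool)
      (computable_snd DBool DBool)).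
    exact: (computable_negb (computable_snd _ _)).
  by move=> [] [].
- exists (fun p => c (p.1.1, p.2.1) && d (p.1.2, p.2.2)).
    apply: computable_andb.
      apply: (computable_comp2 cc); first projection.
      projection.
    apply: (computable_comp2 cd); first projection.
    projection.
  move=> [a1 a2] [b1 b2] /=; split=> [/andP[/cP -> /dP ->] //|[-> ->]].
  by apply/andP; split; [apply/cP|apply/dP].
- exists (fun p => ((size p.1 <= size p.2) && (size p.2 <= size p.1)) &&
    all (fun i => c (nth (dval_default A) p.1 i, nth (dval_default A) p.2 i))
      (iota 0 (size p.1)))%N.
    have c1 := computable_fst (DSeq A) (DSeq A).
    have c2 := computable_snd (DSeq A) (DSeq A).
    apply: computable_andb.
      by apply: computable_andb; apply: computable_leq; apply: computable_size.
    apply: (computable_all_iota (c := fun p : DProd (DProd (DSeq A) (DSeq A)) DNat =>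
      c (nth (dval_default A) p.1.1 p.2, nth (dval_default A) p.1.2 p.2))).
      exact: computable_size.
    apply: (computable_comp2 cc); apply: computable_nth;
      by [projection|projection
         |projection].
  move=> a b /=; rewrite -eqn_leq; split=> [/andP[/eqP sab /allP h]|->].
    apply: (@eq_from_nth _ (dval_default A)) => // i ia.
    by apply/cP/h; rewrite mem_iota.
  by rewrite eqxx /=; apply/allP => i _; apply/cP.
Qed.

(** * Pairing of natural numbers and enumeration of finite data *)

Definition diagonal_step (p : nat * nat) : nat * nat :=
  if (p.2 <= 0)%N then (0%N, p.1.+1) else (p.1.+1, p.2.-1).

(** Cantor's walk along the antidiagonals: [(i, j.+1)] is followed by [(i.+1, j)], and [(i, 0)] by
    [(0, i.+1)]. *)
Definition unpair (n : nat) : nat * nat := iter n diagonal_step (0, 0)%N.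

(** Induction on the antidiagonal [i + j], then on [i], each time looking up the predecessor on the
    walk. *)
Lemma unpair_surj (i j : nat) : exists n, unpair n = (i, j).
Proof.
move: {2}(i + j)%N (erefl (i + j)%N) => s; elim: s i j => [|s IHs] i j.
  by move=> /eqP; rewrite addn_eq0 => /andP[/eqP -> /eqP ->]; exists 0%N.
elim: i j => [|i IHi] j.
  rewrite add0n => ->; have [n nE] := IHs s 0%N (addn0 s).
  by exists n.+1; rewrite /unpair iterS -/(unpair n) nE.
rewrite addSnnS => /IHi[n nE].
by exists n.+1; rewrite /unpair iterS -/(unpair n) nE.
Qed.

Lemma computable_unpair (A : dtype) (f : A -> DNat) :
  computable f -> @computable A (DProd DNat DNat) (fun a => unpair (f a)).
Proof.
move=> cf.
apply: (computable_ext _ (computable_nat_rect (B := DProd DNat DNat)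
  (f := fun=> (0, 0)%N)
  (g := fun p => (if (p.2.2.2 <= 0)%N then (0%N, p.2.2.1.+1)
    else (p.2.2.1.+1, p.2.2.2.-1))) cf _ _)).
- by move=> a; elim: (f a) => //= n ->.
- by apply: computable_pair; exact: computable_zero.
- set X := DProd A _.
  have c1 : @computable X DNat (fun p => p.2.2.1).
    projection.
  have c2 : @computable X DNat (fun p => p.2.2.2).
    projection.
  apply: (@computable_if X (DProd DNat DNat) (fun p => p.2.2.2 <= 0)%N
    (fun p => (0%N, p.2.2.1.+1)) (fun p => (p.2.2.1.+1, p.2.2.2.-1))).
  + by apply: computable_leq => //; exact: computable_zero.
  + by apply: computable_pair; [exact: computable_zero|exact: computable_S].
  + by apply: computable_pair; [exact: computable_S|exact: computable_pred].
Qed.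

Lemma computable_enumeration (A : dtype) : exists2 e : DNat -> A, computable e &
  forall a, exists n, e n = a.
Proof.
elim: A => [||A [e ce eP] B [f cf fP]|A [e ce eP]].
- by exists id; [exact: computable_id|move=> a; exists a].
- exists (fun n => n <= 0)%N.
    by apply: computable_leq; [exact: computable_id|exact: computable_zero].
  by move=> [|]; [exists 0%N|exists 1%N].
- exists (fun n => (e (unpair n).1, f (unpair n).2)).
    have cu := computable_unpair (computable_id DNat).
    apply: computable_pair.
      by apply: (computable_comp ce); exact: (@computable_pr1 _ DNat DNat _ cu).
    by apply: (computable_comp cf); exact: (@computable_pr2 _ DNat DNat _ cu).
  move=> [a b]; have [i <-] := eP a; have [j <-] := fP b.
  by have [n nE] := unpair_surj i j; exists n; rewrite nE.
(* A number splits into a length and a seed. Each step unpairs the seed, decodes one entry from the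
   first half and keeps the second half as the next seed. *)
- pose st (p : DProd (DSeq A) DNat) : DProd (DSeq A) DNat :=
    (e (unpair p.2).1 :: p.1, (unpair p.2).2).
  exists (fun n => (nat_rect (fun=> dval (DProd (DSeq A) DNat))
    ([::], (unpair n).2) (fun k b => st b) (unpair n).1).1).
    have cu := computable_unpair (computable_id DNat).
    apply: (@computable_pr1 _ (DSeq A) DNat).
    apply: (computable_nat_rect (B := DProd (DSeq A) DNat)
      (g := fun p => st p.2.2)).
    + exact: (@computable_pr1 _ DNat DNat _ cu).
    + by apply: computable_pair; [exact: computable_nil|exact: (@computable_pr2 _ DNat DNat _ cu)].
    + apply: (@computable_comp _ _ _ st); last first.
        projection.
      have cv := computable_unpair (computable_snd (DSeq A) DNat).
      apply: computable_pair; last exact: (@computable_pr2 _ DNat DNat _ cv).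
      apply: computable_cons_seq; last projection.
      by apply: (computable_comp ce); exact: (@computable_pr1 _ DNat DNat _ cv).
  (* Entries are pushed on the front and so come out reversed, which is why [key] is later applied
     to [rev l]. The seed is built from the last pushed entry backwards. *)
  have key : forall (l acc : seq A), exists j,
      (iter (size l) st (acc, j)).1 = catrev l acc.
    elim=> [|a l IH] acc; first by exists 0%N.
    have [j jE] := IH (a :: acc); have [i iE] := eP a.
    have [n nE] := unpair_surj i j; exists n.
    by rewrite [size _]/= iterSr {2}/st nE iE.
  move=> l; have [j jE] := key (rev l) [::].
  have [n nE] := unpair_surj (size (rev l)) j; exists n; rewrite nE [LHS]/=.
  transitivity (rev (rev l)); last exact: revK.
  rewrite [RHS]/rev -jE; congr fst.
Qed.

(** Recursive enumerability in existential form, which makes the closure properties short;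
    [enumerable_semidecidable] ties it to [enumerable]. *)
Definition semidecidable (A : dtype) (S : A -> Prop) : Prop :=
  exists2 c : DProd A DNat -> DBool, computable c &
    forall a, S a <-> exists n, c (a, n).

Lemma semidecidable_ext (A : dtype) (S S' : A -> Prop) :
  (forall a, S a <-> S' a) -> semidecidable S -> semidecidable S'.
Proof. by move=> SS' [c cc cP]; exists c => // a; rewrite -SS'. Qed.

Lemma semidecidable_computable (A : dtype) (c : A -> DBool) :
  computable c -> semidecidable (fun a => c a).
Proof.
move=> cc; exists (fun p => c p.1).
  by apply: (computable_comp cc); projection.
by move=> a; split=> [ca|[_]//]; exists 0%N.
Qed.

Lemma semidecidable_preimage (A B : dtype) (f : A -> B) (S : B -> Prop) :
  computable f -> semidecidable S -> semidecidable (fun a => S (f a)).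
Proof.
move=> cf [c cc cP]; exists (fun p => c (f p.1, p.2)) => [|a]; last exact: cP.
apply: (computable_comp2 cc); last projection.
by apply: (computable_comp cf); projection.
Qed.

Lemma semidecidable_ex_nat (A : dtype) (S : DProd A DNat -> Prop) :
  semidecidable S -> semidecidable (fun a => exists n : nat, S (a, n)).
Proof.
move=> [c cc cP].
exists (fun p => c ((p.1, (unpair p.2).1), (unpair p.2).2)).
  have cu := computable_unpair (computable_snd A DNat).
  apply: (computable_comp2 cc); last exact: (@computable_pr2 _ DNat DNat _ cu).
  by apply: computable_pair; [projection|exact: (@computable_pr1 _ DNat DNat _ cu)].
move=> a; split=> [[n /cP[k ck]]|[k ck]].
  by have [i iE] := unpair_surj n k; exists i; rewrite iE.
by exists (unpair k).1; apply/cP; exists (unpair k).2.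
Qed.

Lemma semidecidable_ex (A B : dtype) (S : DProd A B -> Prop) :
  semidecidable S -> semidecidable (fun a => exists b : B, S (a, b)).
Proof.
move=> sS; have [e ce eP] := computable_enumeration B.
apply: (semidecidable_ext _ (semidecidable_ex_nat
  (S := fun p => S (p.1, e p.2)) _)).
  move=> a; split=> [[n Sn]|[b]]; first by exists (e n).
  by have [n <-] := eP b; exists n.
apply: (@semidecidable_preimage (DProd A DNat) (DProd A B)
  (fun p => (p.1, e p.2)) S) => //.
apply: computable_pair; first projection.
by apply: (computable_comp ce); projection.
Qed.

Lemma semidecidable_and (A : dtype) (S S' : A -> Prop) :
  semidecidable S -> semidecidable S' -> semidecidable (fun a => S a /\ S' a).
Proof.
move=> [c cc cP] [d cd dP].
exists (fun p => c (p.1, (unpair p.2).1) && d (p.1, (unpair p.2).2)).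
  have cu := computable_unpair (computable_snd A DNat).
  apply: computable_andb.
    by apply: (computable_comp2 cc); [projection|exact: (@computable_pr1 _ DNat DNat _ cu)].
  by apply: (computable_comp2 cd); [projection|exact: (@computable_pr2 _ DNat DNat _ cu)].
move=> a; split=> [[/cP[n cn] /dP[k dk]]|[n /andP[cn dn]]].
  by have [i iE] := unpair_surj n k; exists i; rewrite iE; apply/andP.
by split; [apply/cP; eexists; exact: cn|apply/dP; eexists; exact: dn].
Qed.

Lemma semidecidable_or (A : dtype) (S S' : A -> Prop) :
  semidecidable S -> semidecidable S' -> semidecidable (fun a => S a \/ S' a).
Proof.
move=> [c cc cP] [d cd dP].
exists (fun p => c p || d p); first exact: computable_orb.
move=> a; split=> [[/cP|/dP] [n cn]|[n /orP[cn|dn]]].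
- by exists n; rewrite cn.
- by exists n; rewrite cn orbT.
- by left; apply/cP; exists n.
- by right; apply/dP; exists n.
Qed.

(** Finitely many witnesses have a common bound, so one number bounding all the searches replaces a
    witness for each [i]. *)
Lemma semidecidable_all_lt (A : dtype) (n : A -> DNat) (S : DProd A DNat -> Prop) :
  computable n -> semidecidable S ->
  semidecidable (fun a => forall i, (i < n a)%N -> S (a, i)).
Proof.
move=> cn [c cc cP].
exists (fun p => all (fun i => has (fun k => c ((p.1, i), k)) (iota 0 p.2))
  (iota 0 (n p.1))).
  apply: (computable_all_iota (c := fun r : DProd (DProd A DNat) DNat =>
    has (fun k => c ((r.1.1, r.2), k)) (iota 0 r.1.2))).
    by apply: (computable_comp cn); projection.
  apply: (computable_has_iota (c := fun r : DProd (DProd (DProd A DNat) DNat) DNat =>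
    c ((r.1.1.1, r.1.2), r.2))).
    projection.
  apply: (computable_comp2 cc); last projection.
  apply: computable_pair; last projection.
  projection.
move=> a; split=> [Sa|[k /allP ka] i ia]; last first.
  have /hasP[j _ cj] : has (fun k => c (a, i, k)) (iota 0 k).
    by apply: ka; rewrite mem_iota.
  by apply/cP; exists j.
have /choice[b bP] : forall i, exists k, (i < n a)%N -> c (a, i, k).
  move=> i; case: (ltnP i (n a)) => [/Sa/cP[k ck]|_]; first by exists k.
  by exists 0%N.
(* One more than the largest witness, because [iota 0 k] stops before [k]. *)
exists (\max_(i < n a) b i).+1; apply/allP => i; rewrite mem_iota add0n => /= ia.
suff : has (fun k => c (a, i, k)) (iota 0 (\max_(j < n a) b j).+1) by [].
apply/hasP; exists (b i); last exact: bP.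
by rewrite mem_iota /= add0n ltnS; apply: (leq_bigmax (Ordinal ia)).
Qed.

Lemma semidecidable_eq (A B : dtype) (f g : A -> B) :
  computable f -> computable g -> semidecidable (fun a => f a = g a).
Proof.
move=> cf cg; have [c cc cP] := computable_eq B.
apply: (semidecidable_ext _ (semidecidable_computable (computable_comp2 cc cf cg))).
by move=> a; exact: cP.
Qed.

Lemma enumerable_semidecidable (A : dtype) (S : set A) :
  enumerable S <-> semidecidable S.
Proof.
split=> [[->|[e ce ->]]|[c cc cP]].
- exists (fun=> false); first exact: computable_bool.
  by move=> a; split=> // -[].
- apply: (semidecidable_ext _ (semidecidable_ex_nat
    (semidecidable_eq (computable_comp ce (computable_snd A DNat))
      (computable_fst A DNat)))).
  by move=> a; split=> [[n /= <-]|[n _ <-]]; exists n.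
- have [[a0 S0]|nS] := pselect (exists a, S a); last first.
    by left; apply/seteqP; split=> // a Sa; apply: nS; exists a.
  right; have [e ce eP] := computable_enumeration A.
  have [n0 n0E] := eP a0.
  (* [n] codes a candidate together with a possible witness; failing pairs output a fixed member of
     the set. That member is written [e n0] so that the constant function is visibly computable. *)
  pose t n := if c (e (unpair n).1, (unpair n).2) then e (unpair n).1 else e n0.
  exists t.
    have cu := computable_unpair (computable_id DNat).
    have ce1 : computable (fun n : DNat => e (unpair n).1).
      by apply: (computable_comp ce); exact: (@computable_pr1 _ DNat DNat _ cu).
    apply: computable_if => //; last exact: (computable_comp ce (computable_nat _ _)).
    by apply: (computable_comp2 cc) => //; exact: (@computable_pr2 _ DNat DNat _ cu).
  apply/seteqP; split=> [a /cP[k]|_ [n _ <-]].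
    have [n <-] := eP a => ck; have [i iE] := unpair_surj n k.
    by exists i => //; rewrite /t iE ck.
  rewrite /t; case: ifPn => [cn|_]; last by rewrite n0E.
  by apply/cP; eexists; exact: cn.
Qed.

(** * Names of rationals *)

(** Denominators are stored minus one: [u.2 * v.2 + u.2 + v.2] is one less than [u.2.+1 * v.2.+1].
    The same shift occurs in [rat_mul] and [rat_divS]. *)
Definition rat_add (u v : DRat) : DRat :=
  ((u.1.1 * v.2.+1 + v.1.1 * u.2.+1, u.1.2 * v.2.+1 + v.1.2 * u.2.+1),
   u.2 * v.2 + u.2 + v.2)%N.

Definition rat_opp (u : DRat) : DRat := ((u.1.2, u.1.1), u.2).

Definition rat_mul (u v : DRat) : DRat :=
  ((u.1.1 * v.1.1 + u.1.2 * v.1.2, u.1.1 * v.1.2 + u.1.2 * v.1.1),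
   u.2 * v.2 + u.2 + v.2)%N.

Definition rat_divS (u : DRat) (k : nat) : DRat := (u.1, u.2 * k + u.2 + k)%N.

Definition rat_nat (n : nat) : DRat := ((n, 0), 0)%N.

(** Cross-multiplied, with negative parts moved to the other side so that only natural numbers are
    compared. *)
Definition rat_le (u v : DRat) : bool :=
  (u.1.1 * v.2.+1 + v.1.2 * u.2.+1 <= v.1.1 * u.2.+1 + u.1.2 * v.2.+1)%N.

Definition rat_lt (u v : DRat) : bool := ~~ rat_le v u.

Definition rat_sum (l : DSeq DRat) : DRat := foldr rat_add (rat_nat 0) l.

Section RatVal.
Variable R : realType.
Implicit Types u v : DRat.
Local Notation rv := (rat_val R).

Let denE (a b : nat) : (a * b + a + b).+1%:R = a.+1%:R * b.+1%:R :> R.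
Proof. by rewrite -natrM; congr _%:R; lia. Qed.

Lemma rat_val_add u v : rv (rat_add u v) = rv u + rv v.
Proof.
rewrite /rat_val /= denE !natrD !natrM.
have : u.2.+1%:R != 0 :> R by rewrite pnatr_eq0.
have : v.2.+1%:R != 0 :> R by rewrite pnatr_eq0.
by move: (u.2.+1%:R) (v.2.+1%:R) => a b a0 b0; field; apply/andP.
Qed.

Lemma rat_val_opp u : rv (rat_opp u) = - rv u.
Proof. by rewrite /rat_val /= -mulNr opprB. Qed.

Lemma rat_val_mul u v : rv (rat_mul u v) = rv u * rv v.
Proof.
rewrite /rat_val /= denE !natrD !natrM.
have : u.2.+1%:R != 0 :> R by rewrite pnatr_eq0.
have : v.2.+1%:R != 0 :> R by rewrite pnatr_eq0.
by move: (u.2.+1%:R) (v.2.+1%:R) => a b a0 b0; field; apply/andP.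
Qed.

Lemma rat_val_divS u k : rv (rat_divS u k) = rv u / k.+1%:R.
Proof. by rewrite /rat_val /= denE invfM mulrA. Qed.

Lemma rat_val_nat n : rv (rat_nat n) = n%:R.
Proof. by rewrite /rat_val /= subr0 divr1. Qed.

Lemma rat_val_le u v : rat_le u v = (rv u <= rv v).
Proof.
rewrite /rat_val ler_pdivrMr ?ltr0Sn // mulrAC ler_pdivlMr ?ltr0Sn //.
rewrite /rat_le -(ler_nat R) !natrD !natrM !mulrBl.
by apply/idP/idP; lra.
Qed.

Lemma rat_val_lt u v : rat_lt u v = (rv u < rv v).
Proof. by rewrite /rat_lt rat_val_le ltNge. Qed.

Lemma rat_val_sum (l : DSeq DRat) : rv (rat_sum l) = \sum_(u <- l) rv u.
Proof.
elim: l => [|u l IH]; first by rewrite big_nil rat_val_nat.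
by rewrite big_cons -IH -rat_val_add.
Qed.

Lemma rat_val_dense (x y : R) : x < y -> exists u, x < rv u < y.
Proof.
move=> /rat_in_itvoo[q /itvP qP].
pose n := numq q; pose d := `|denq q|%N.
have d0 : (0 < d)%N by rewrite absz_gt0 denq_neq0.
(* A name of [q]: its sign decides which numerator slot holds the absolute value, and the
   denominator is lowered by one. *)
exists ((if n is Posz k then (k, 0) else (0, `|n|))%N, d.-1).
suff -> : rv ((if n is Posz k then (k, 0) else (0, `|n|))%N, d.-1) = ratr q.
  by rewrite !qP.
rewrite /rat_val /= prednK // /ratr.
have -> : (denq q)%:~R = d%:R :> R.
  by rewrite -[LHS]/(_ : R) -{1}absz_denq pmulrn.
congr (_ / _); rewrite -/n; case: n => k /=; first by rewrite subr0.
by rewrite sub0r NegzE mulrNz.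
Qed.

Lemma rat_val_dense_ereal (x : R) (y : \bar R) : (x%:E < y)%E ->
  exists u, x < rv u /\ ((rv u)%:E < y)%E.
Proof.
case: y => [y|_|//].
  by rewrite lte_fin => /rat_val_dense[u /andP[xu uy]]; exists u; rewrite lte_fin.
have [u /andP[xu _]] := @rat_val_dense x (x + 1) ltac:(by rewrite ltrDl).
by exists u; rewrite ltry.
Qed.

End RatVal.

Ltac computability :=
  repeat first
  [ projection
  | match goal with H : @computable _ _ _ |- _ => projection_from H end
  | apply: computable_zero | apply: computable_nat | apply: computable_bool
  | apply: computable_pair | apply: computable_S
  | apply: computable_pred | apply: computable_addn | apply: computable_muln
  | apply: computable_leq | apply: computable_negb ].

Lemma computable_rat_add (A : dtype) (f g : A -> DRat) :
  computable f -> computable g -> computable (fun a => rat_add (f a) (g a)).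
Proof. by move=> cf cg; rewrite /rat_add; computability. Qed.

Lemma computable_rat_opp (A : dtype) (f : A -> DRat) :
  computable f -> computable (fun a => rat_opp (f a)).
Proof. by move=> cf; rewrite /rat_opp; computability. Qed.

Lemma computable_rat_mul (A : dtype) (f g : A -> DRat) :
  computable f -> computable g -> computable (fun a => rat_mul (f a) (g a)).
Proof. by move=> cf cg; rewrite /rat_mul; computability. Qed.

Lemma computable_rat_divS (A : dtype) (f : A -> DRat) (n : A -> DNat) :
  computable f -> computable n -> computable (fun a => rat_divS (f a) (n a)).
Proof. by move=> cf cg; rewrite /rat_divS; computability. Qed.

Lemma computable_rat_nat (A : dtype) (n : A -> DNat) :
  computable n -> computable (fun a => rat_nat (n a)).
Proof. by move=> cn; rewrite /rat_nat; computability. Qed.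

Lemma computable_rat_le (A : dtype) (f g : A -> DRat) :
  computable f -> computable g -> @computable A DBool (fun a => rat_le (f a) (g a)).
Proof. by move=> cf cg; rewrite /rat_le; computability. Qed.

Lemma computable_rat_lt (A : dtype) (f g : A -> DRat) :
  computable f -> computable g -> @computable A DBool (fun a => rat_lt (f a) (g a)).
Proof. by move=> cf cg; apply/computable_negb/computable_rat_le. Qed.

Lemma computable_rat_sum (A : dtype) (f : A -> DSeq DRat) :
  computable f -> computable (fun a => rat_sum (f a)).
Proof.
move=> cf; apply: (computable_foldr_seq (B := DRat) (E := DRat)
  (g := fun p => rat_add p.2.1 p.2.2)) => //.
  by apply: computable_rat_nat; exact: computable_zero.
by apply: computable_rat_add; projection.
Qed.

(** * Effectively open sets of measures *)

Section EffectivelyOpen.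
Variable R : realType.
Local Notation Measures := (Measures R).
Implicit Types (A B : dtype) (P : Measures).

(** Open sets of measures, effective uniformly in a parameter [a]. Lower semicomputability on words
    is this property for the superlevel sets; see [lower_semicomputable_word]. *)
Definition effectively_open A (U : A -> Measures -> Prop) : Prop :=
  exists2 S : DProd A (DSeq DCond) -> Prop, semidecidable S &
    forall a P, U a P <-> exists2 s, S (a, s) & basic_measures s P.

Lemma basic_measures_cons k (s : DSeq DCond) P :
  basic_measures (k :: s) P <-> cond_holds P k /\ basic_measures s P.
Proof.
split=> [h|[hk hs] k' [<- //|/hs //]].
by split=> [|k' sk']; apply: h; [left|right].
Qed.

Lemma basic_measures_cat (s s' : DSeq DCond) P :
  basic_measures (s ++ s') P <-> basic_measures s P /\ basic_measures s' P.
Proof.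
elim: s => [|k s IH]; first by split=> [h|[]//]; split.
rewrite [_ ++ _]/= !basic_measures_cons.
by split=> [[hk /IH[hs hs']]|[[hk hs] hs']]; split=> //; exact/IH.
Qed.

Lemma basic_measures_flatten (L : DSeq (DSeq DCond)) P :
  basic_measures (flatten L) P <->
  forall i, basic_measures (nth [::] L i) P.
Proof.
elim: L => [|s L IH]; first by split=> // _ i; rewrite nth_nil.
rewrite [flatten _]/= basic_measures_cat; split=> [[hs /IH hL]|h].
  by case=> [|i]; [exact: hs|exact: hL].
by split; [exact: (h 0%N)|apply/IH => i; exact: (h i.+1)].
Qed.

Lemma effectively_open_ext A (U V : A -> Measures -> Prop) :
  (forall a P, U a P <-> V a P) -> effectively_open U -> effectively_open V.
Proof. by move=> UV [S sS SP]; exists S => // a P; rewrite -UV. Qed.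

Lemma effectively_open_semidecidable A (S : A -> Prop) :
  semidecidable S -> effectively_open (fun a P => S a).
Proof.
move=> sS; exists (fun p => S p.1).
  by apply: (semidecidable_preimage _ sS); projection.
move=> a P; split=> [Sa|[s]//].
by exists [::].
Qed.

Lemma effectively_open_computable A (c : A -> DBool) :
  computable c -> effectively_open (fun a P => c a).
Proof.
by move=> cc; exact/effectively_open_semidecidable/semidecidable_computable.
Qed.

Lemma effectively_open_cond A (k : A -> DCond) :
  computable k -> effectively_open (fun a P => cond_holds P (k a)).
Proof.
move=> ck; exists (fun p => p.2 = [:: k p.1]).
  apply: (@semidecidable_eq _ (DSeq DCond)); first by projection.
  apply: computable_cons_seq; last exact: computable_nil.
  by apply: (computable_comp ck); projection.
move=> a P; split=> [ka|[s /= -> /basic_measures_cons[]//]].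
by exists [:: k a] => //; apply/basic_measures_cons.
Qed.

Lemma effectively_open_preimage A B (f : A -> B) (U : B -> Measures -> Prop) :
  computable f -> effectively_open U -> effectively_open (fun a => U (f a)).
Proof.
move=> cf [S sS SP]; exists (fun p => S (f p.1, p.2)) => [|a P]; last exact: SP.
apply: (semidecidable_preimage (f := fun p : DProd A (DSeq DCond) =>
  (f p.1, p.2) : DProd B (DSeq DCond)) _ sS).
apply: computable_pair; last by projection.
by apply: (computable_comp cf); projection.
Qed.

Lemma effectively_open_or A (U V : A -> Measures -> Prop) :
  effectively_open U -> effectively_open V ->
  effectively_open (fun a P => U a P \/ V a P).
Proof.
move=> [S sS SP] [T sT TP]; exists (fun p => S p \/ T p).
  exact: semidecidable_or.
move=> a P; rewrite SP TP.
by split=> [[[s]|[s]]|[s [|]]]; [exists s; [left|]|exists s; [right|]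
  |left; exists s|right; exists s].
Qed.

Lemma effectively_open_ex A B (U : DProd A B -> Measures -> Prop) :
  effectively_open U -> effectively_open (fun a P => exists b, U (a, b) P).
Proof.
move=> [S sS SP]; exists (fun p => exists b : B, S ((p.1, b), p.2)).
  apply: (@semidecidable_ex (DProd A (DSeq DCond)) B
    (fun p => S ((p.1.1, p.2), p.1.2))).
  apply: (semidecidable_preimage (f := fun p : DProd (DProd A (DSeq DCond)) B =>
    ((p.1.1, p.2), p.1.2) : DProd (DProd A B) (DSeq DCond)) _ sS).
  by computability.
move=> a P; split=> [[b /SP[s Ss sP]]|[s [b Sb] sP]].
  by exists s => //; exists b.
by exists b; apply/SP; exists s.
Qed.

(** Concatenating two lists of conditions names the intersection of the two basic sets. *)
Lemma effectively_open_and A (U V : A -> Measures -> Prop) :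
  effectively_open U -> effectively_open V ->
  effectively_open (fun a P => U a P /\ V a P).
Proof.
move=> [S sS SP] [T sT TP].
exists (fun p => exists r : DProd (DSeq DCond) (DSeq DCond),
  (S (p.1, r.1) /\ T (p.1, r.2)) /\ p.2 = r.1 ++ r.2).
  apply: (@semidecidable_ex (DProd A (DSeq DCond))
    (DProd (DSeq DCond) (DSeq DCond)) (fun p =>
    (S (p.1.1, p.2.1) /\ T (p.1.1, p.2.2)) /\ p.1.2 = p.2.1 ++ p.2.2)).
  set D := DProd _ (DProd _ _).
  apply: semidecidable_and; first apply: semidecidable_and.
  - apply: (semidecidable_preimage
      (f := fun p : D => (p.1.1, p.2.1) : DProd A (DSeq DCond)) _ sS).
    by computability.
  - apply: (semidecidable_preimage
      (f := fun p : D => (p.1.1, p.2.2) : DProd A (DSeq DCond)) _ sT).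
    by computability.
  - apply: (@semidecidable_eq _ (DSeq DCond)); first by projection.
    by apply: computable_cat; projection.
move=> a P; rewrite SP TP; split=> [[[s Ss sP] [s' Ts' s'P]]|].
  exists (s ++ s'); first by exists (s, s').
  exact/basic_measures_cat.
move=> [_ [[s s'] /= [[Ss Ts'] ->]] /basic_measures_cat[sP s'P]].
by split; [exists s|exists s'].
Qed.

(** A finite intersection of basic sets is basic: [L] collects one name per index and [flatten L]
    names the intersection. Positions past the end of [L] read as [[::]], which imposes nothing. *)
Lemma effectively_open_all_lt A (n : A -> DNat)
    (U : DProd A DNat -> Measures -> Prop) :
  computable n -> effectively_open U ->
  effectively_open (fun a P => forall i : nat, (i < n a)%N -> U (a, i) P).
Proof.
move=> cn [S sS SP].
exists (fun p => exists L : DSeq (DSeq DCond),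
  (forall i, (i < n p.1)%N -> S ((p.1, i), nth [::] L i)) /\ p.2 = flatten L).
  pose D := DProd (DProd A (DSeq DCond)) (DSeq (DSeq DCond)).
  apply: (@semidecidable_ex (DProd A (DSeq DCond)) (DSeq (DSeq DCond)) (fun p =>
    (forall i, (i < n p.1.1)%N -> S ((p.1.1, i), nth [::] p.2 i)) /\
    p.1.2 = flatten p.2)).
  apply: semidecidable_and.
    apply: (@semidecidable_all_lt D (fun p => n p.1.1)
      (fun q => S ((q.1.1.1, q.2), nth [::] q.1.2 q.2))).
      by apply: (computable_comp cn); projection.
    apply: (semidecidable_preimage (f := fun q : DProd D DNat =>
      ((q.1.1.1, q.2), nth [::] q.1.2 q.2)
      : DProd (DProd A DNat) (DSeq DCond)) _ sS).
    apply: computable_pair; first by computability.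
    by apply: (@computable_nth _ (DSeq DCond)); projection.
  apply: (@semidecidable_eq _ (DSeq DCond)); first by projection.
  by apply: computable_flatten; projection.
move=> a P; split=> [UP|[_ [L /= [LS ->]] /basic_measures_flatten LP] i ia]; last first.
  by apply/SP; exists (nth [::] L i); [exact: LS|exact: LP].
have /choice[b bP] : forall i, exists s : DSeq DCond,
    basic_measures s P /\ ((i < n a)%N -> S ((a, i), s)).
  move=> i; case: (ltnP i (n a)) => [/UP/SP[s Ss sP]|_]; first by exists s.
  by exists [::]; split.
exists (flatten (mkseq b (n a))).
  exists (mkseq b (n a)); split=> // i ia; rewrite nth_mkseq //.
  by have [_] := bP i; apply.
apply/basic_measures_flatten => i; case: (ltnP i (n a)) => ia.
  by rewrite nth_mkseq //; have [] := bP i.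
by rewrite nth_default ?size_mkseq.
Qed.

Lemma effectively_open_ex_lt A (n : A -> DNat)
    (U : DProd A DNat -> Measures -> Prop) :
  computable n -> effectively_open U ->
  effectively_open (fun a P => exists2 i : nat, (i < n a)%N & U (a, i) P).
Proof.
move=> cn oU.
apply: (effectively_open_ext _ (@effectively_open_ex A DNat
  (fun p P => (p.2 < n p.1)%N /\ U p P) _)).
  by move=> a P; split=> [[i [ia Ui]]|[i ia Ui]]; exists i.
apply: effectively_open_and => //; apply: effectively_open_computable.
apply: computable_leq; first by computability.
by apply: (computable_comp cn); projection.
Qed.

(** * Masses of cylinders and criteria for lower semicomputability *)

Lemma cylinder_measurable (x : word) : measurable (cylinder x : set Omega).
Proof. by apply: sub_sigma_algebra; exists x. Qed.

Lemma mass_ge0 P x : (0 <= mass P x)%E.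
Proof. exact: measure_ge0. Qed.

Lemma mass_le1 P x : (mass P x <= 1)%E.
Proof. by apply: probability_le1; exact: cylinder_measurable. Qed.

Lemma mass_fin_num P x : mass P x \is a fin_num.
Proof.
by rewrite ge0_fin_numE ?mass_ge0 // (le_lt_trans (mass_le1 P x)) ?ltry.
Qed.

(** Basic conditions are two-sided; the lower bound [-1] is vacuous for a mass. *)
Lemma effectively_open_mass_lt A (x : A -> DWord) (r : A -> DRat) :
  computable x -> computable r ->
  effectively_open (fun a P => mass P (x a) < (rat_val R (r a))%:E)%E.
Proof.
move=> cx cr.
apply: (effectively_open_ext _ (@effectively_open_cond A
  (fun a => ((rat_opp (rat_nat 1), r a), x a)) _)).
  move=> a P; rewrite /cond_holds /= rat_val_opp rat_val_nat.
  split=> [[]//|h]; split=> //.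
  by apply: lt_le_trans (mass_ge0 P (x a)); rewrite lte_fin oppr_lt0 ltr01.
apply: computable_pair => //; apply: computable_pair => //.
by apply/computable_rat_opp/computable_rat_nat/computable_nat.
Qed.

(** Here the vacuous bound is the upper one, [2], since masses are at most [1]. *)
Lemma effectively_open_mass_gt A (x : A -> DWord) (r : A -> DRat) :
  computable x -> computable r ->
  effectively_open (fun a P => (rat_val R (r a))%:E < mass P (x a))%E.
Proof.
move=> cx cr.
apply: (effectively_open_ext _ (@effectively_open_cond A
  (fun a => ((r a, rat_nat 2), x a)) _)).
  move=> a P; rewrite /cond_holds /= rat_val_nat.
  split=> [[]//|h]; split=> //.
  by apply: le_lt_trans (mass_le1 P (x a)) _; rewrite lte_fin ltr1n.
apply: computable_pair => //; apply: computable_pair => //.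
exact/computable_rat_nat/computable_nat.
Qed.

Lemma lower_semicomputable_word (m : word -> Measures -> \bar R) :
  lower_semicomputable (fun x => [set x]) m <->
  effectively_open (fun (a : DProd DRat DWord) P =>
    ((rat_val R a.1)%:E < m a.2 P)%E).
Proof.
split=> [[S /enumerable_semidecidable sS SP]|[S sS SP]].
  exists (fun p => S (p.1.1, (p.1.2, p.2))).
    apply: (semidecidable_preimage
      (f := fun p : DProd (DProd DRat DWord) (DSeq DCond) =>
      (p.1.1, (p.1.2, p.2)) : DProd DRat DBasic) _ sS).
    by computability.
  move=> [q x] P; have := SP q; rewrite predeqE => /(_ (x, P)) /= ->.
  split=> [[[y s] /= Ss [-> sP]]|[s Ss sP]]; first by exists s.
  by exists (x, s).
exists (fun p => S ((p.1, p.2.1), p.2.2)).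
  apply/enumerable_semidecidable.
  apply: (semidecidable_preimage (f := fun p : DProd DRat DBasic =>
    ((p.1, p.2.1), p.2.2) : DProd (DProd DRat DWord) (DSeq DCond)) _ sS).
  by computability.
move=> q; rewrite predeqE => -[x P] /=.
rewrite (SP (q, x) P); split=> [[s Ss sP]|[[y s] /= Ss [-> sP]]].
  by exists (x, s).
by exists s.
Qed.

(** [V (q, x)] collects the measures for which the prefix [x] alone certifies a value above [q].
    Each basic set inside it, paired with the cylinder of [x], is a basic open set of the
    product. *)
Lemma lower_semicomputable_Omega (t : Omega -> Measures -> \bar R)
    (V : DProd DRat DWord -> Measures -> Prop) :
  effectively_open V ->
  (forall q w P, ((rat_val R q)%:E < t w P)%E <->
    exists2 x : word, prefix_of x w & V (q, x) P) ->
  lower_semicomputable cylinder t.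
Proof.
move=> [S sS SP] tV; exists (fun p => S ((p.1, p.2.1), p.2.2)).
  apply/enumerable_semidecidable.
  apply: (semidecidable_preimage (f := fun p : DProd DRat DBasic =>
    ((p.1, p.2.1), p.2.2) : DProd (DProd DRat DWord) (DSeq DCond)) _ sS).
  by computability.
move=> q; rewrite predeqE => -[w P] /=; rewrite tV.
split=> [[x xw /SP[s Ss sP]]|[[x s] /= Ss [xw sP]]]; first by exists (x, s).
by exists x => //; apply/SP; exists s.
Qed.

End EffectivelyOpen.

(** * Numerical codes of finite data, and prefixes as initial segments *)

Lemma computable_injection (A : dtype) :
  exists2 code : A -> DNat, computable code & injective code.
Proof.
have [e ce eP] := computable_enumeration A.
have [c cc cP] := computable_eq A.
have ex (a : A) : exists n, c (e n, a) by have [n en] := eP a; exists n; apply/cP.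
(* The code of [a] is its least index in a surjective enumeration, found by regular minimization; an
   index determines its element. *)
exists (fun a => ex_minn (ex a)).
  apply: (computable_mu (c := fun p => c (e p.2, p.1))).
  - apply: (computable_comp2 cc); last by projection.
    by apply: (computable_comp ce); projection.
  - by move=> a /=; case: ex_minnP.
  - move=> a n; case: ex_minnP => k _ kP nk; apply/negP => /kP.
    by rewrite leqNgt nk.
move=> a b; case: ex_minnP => n /cP <- _; case: ex_minnP => k /cP <- _.
by move=> ->.
Qed.

Lemma prefix_ofE (x : word) (w : nat -> bool) :
  prefix_of x w <-> x = mkseq w (size x).
Proof.
split=> [xw|->]; last by move=> i; rewrite size_mkseq => ix; rewrite nth_mkseq.
apply: (@eq_from_nth _ false); first by rewrite size_mkseq.
by move=> i ix; rewrite nth_mkseq // xw.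
Qed.

Lemma mkseq_prefix_of (x : word) (w : nat -> bool) (i : nat) :
  prefix_of x w -> (i <= size x)%N -> mkseq (nth false x) i = mkseq w i.
Proof.
move=> xw ix; apply/eq_in_map => j; rewrite mem_iota add0n => /andP[_ ji].
by rewrite xw // (leq_trans ji).
Qed.

(** * Sums over words and over prefixes *)

Section Series.
Variable R : realType.
Local Open Scope ereal_scope.

(** Partial sums increase to the sum, so a strict lower bound is already passed after finitely many
    terms; this lets infinite sums be approximated effectively from below. *)
Lemma nneseries_gtP (a : nat -> \bar R) (x : \bar R) : (forall n, 0 <= a n) ->
  x < \sum_(0 <= n <oo) a n <-> exists n, x < \sum_(0 <= i < n) a i.
Proof.
move=> a0; split=> [xa|[n xa]]; last first.
  exact: (lt_le_trans xa (nneseries_lim_ge _ _)).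
apply: contrapT => /forallNP h; move: xa; apply/negP; rewrite -leNgt.
apply: lime_le; first exact: is_cvg_nneseries.
by apply: nearW => n; rewrite leNgt; apply/negP/h.
Qed.

Lemma nneseries_le (a : nat -> \bar R) (x : \bar R) : (forall n, 0 <= a n) ->
  (forall n, \sum_(0 <= i < n) a i <= x) -> \sum_(0 <= n <oo) a n <= x.
Proof.
move=> a0 ax; rewrite leNgt; apply/negP => /nneseries_gtP[//|n].
by rewrite ltNge ax.
Qed.

Lemma esum_injection (T : choiceType) (code : T -> nat) (a : nat -> \bar R) :
  injective code -> (forall n, 0 <= a n) ->
  \esum_(x in [set: T]) a (code x) <= \sum_(0 <= n <oo) a n.
Proof.
move=> ic a0; rewrite nneseries_esumT // -esum_image; last by move=> x y _ _ /ic.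
by rewrite esum_mkcond; apply: le_esum => n _; case: ifP.
Qed.

(** Turns a sum over a countable type into a series, for which integration term by term is
    available. Numbers that code nothing contribute [0]. *)
Lemma esum_count (T : countType) (a : T -> \bar R) : (forall x, 0 <= a x) ->
  \esum_(x in [set: T]) a x = \sum_(0 <= n <oo) oapp a 0 (pickle_inv n).
Proof.
move=> a0; rewrite nneseries_esumT; last first.
  by move=> n; case: pickle_inv => //=.
transitivity (\esum_(n in pickle @` [set: T]) oapp a 0 (pickle_inv n)).
  rewrite esum_image; last by move=> x y _ _ /(pcan_inj pickleK_inv).
  by apply: eq_esum => x _; rewrite pickleK_inv.
rewrite esum_mkcond; apply: eq_esum => n _; case: ifPn => // /negP h.
case E: (pickle_inv n) => [x|//]; exfalso; apply: h; apply/mem_set; exists x => //.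
by have := @pickle_invK T n; rewrite E.
Qed.

(** The prefixes of [w] are in bijection with their lengths through [mkseq w]. *)
Lemma esum_prefix (w : nat -> bool) (g : word -> \bar R) : (forall x, 0 <= g x) ->
  \esum_(x in [set x : word | prefix_of x w]) g x =
  \sum_(0 <= k <oo) g (mkseq w k).
Proof.
move=> g0; rewrite nneseries_esumT //.
rewrite (reindex_esum [set: nat] [set x : word | prefix_of x w] (mkseq w)) //.
split.
- by move=> k _ /=; apply/prefix_ofE; rewrite size_mkseq.
- by move=> j k _ _ /(congr1 size); rewrite !size_mkseq.
- by move=> x /prefix_ofE xw; exists (size x).
Qed.

Lemma integral_esum_prefix (P : Measures R) (g : word -> \bar R) :
  (forall x, 0 <= g x) ->
  \int[P]_w (\esum_(x in [set x : word | prefix_of x w]) g x) =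
  \esum_(x in [set: word]) (g x * mass P x).
Proof.
move=> g0.
(* Indicators of cylinders extend the sum to all words, so its range no longer depends on [w] and it
   can be exchanged with the integral. *)
pose f (w : Omega) (x : word) : \bar R := g x * (\1_(cylinder x) w)%:E.
have f0 w x : 0 <= f w x by rewrite mule_ge0 ?lee_fin.
transitivity (\int[P]_w (\sum_(0 <= n <oo) oapp (f w) 0 (pickle_inv n))).
  apply: eq_integral => w _; rewrite -esum_count // [LHS]esum_mkcond.
  apply: eq_esum => x _; rewrite /f indicE.
  have -> : (w \in cylinder x) = (x \in [set x : word | prefix_of x w]).
    by apply/idP/idP => /set_mem h; apply/mem_set.
  by case: ifP => _; rewrite ?mule1 ?mule0.
have mc x : measurable_fun [set: Omega] (fun w => (\1_(cylinder x) w : R)%:E).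
  apply/measurable_EFinP; apply: measurable_indic; exact: cylinder_measurable.
rewrite integral_nneseries //; first last.
- by move=> n w _; case: pickle_inv => //=.
- by move=> n; case: pickle_inv => [x|] /=;
    [exact: measurable_funeM|exact: measurable_cst].
rewrite esum_count; last by move=> x; rewrite mule_ge0 ?mass_ge0.
apply: eq_eseriesr => n _; case: pickle_inv => [x|] /=; last first.
  by rewrite integral0.
rewrite ge0_integralZl //.
by rewrite integral_indic ?setIT //; exact: cylinder_measurable.
Qed.

End Series.

(** * The prefix sum is a uniform test *)

Section PrefixSumTest.
Variable R : realType.
Local Notation rv := (rat_val R).
Local Open Scope ereal_scope.

(** The weights [1/((n+1)(n+2))] are placed on words by an injective computable code, independently
    of the measure. Their partial sums telescope to [1 - 1/(n+1)]. *)
Lemma positive_semimeasure : exists2 m : word -> Measures R -> \bar R,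
  uniform_semimeasure m & forall x P, 0 < m x P.
Proof.
have [code ccode icode] := computable_injection DWord.
pose a (n : nat) : DRat := rat_divS (rat_divS (rat_nat 1) n) n.+1.
have aE n : rv (a n) = (n.+1%:R^-1 - n.+2%:R^-1)%R.
  rewrite !rat_val_divS rat_val_nat.
  have : (n.+2%:R != 0 :> R)%R by rewrite pnatr_eq0.
  have : (n.+1%:R != 0 :> R)%R by rewrite pnatr_eq0.
  rewrite -(natr1 n.+1); move: (n.+1%:R)%R => b b0 b1.
  by field; apply/andP.
have a0 n : (0 < rv (a n))%R by rewrite !rat_val_divS rat_val_nat !divr_gt0.
exists (fun x _ => (rv (a (code x)))%:E); last by move=> x P; rewrite lte_fin.
split=> [|x P|P]; last 2 first.
- by rewrite lee_fin ltW.
- apply: (le_trans (esum_injection (a := fun n => (rv (a n))%:E) icode _)).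
    by move=> n; rewrite lee_fin ltW.
  apply: nneseries_le => n; first by rewrite lee_fin ltW.
  suff -> : \sum_(0 <= i < n) (rv (a i))%:E = (1 - n.+1%:R^-1)%:E.
    by rewrite lee_fin lerBlDr lerDl invr_ge0.
  elim: n => [|n IH]; first by rewrite big_geq // invr1 subrr.
  by rewrite big_nat_recr //= IH aE -EFinD; congr EFin; ring.
apply/lower_semicomputable_word.
apply: (effectively_open_ext _ (@effectively_open_computable R (DProd DRat DWord)
  (fun p => rat_lt p.1 (a (code p.2))) _)).
  by move=> [q x] P /=; rewrite (rat_val_lt R) lte_fin.
have cc : computable (fun p : DProd DRat DWord => code p.2).
  by apply: (computable_comp ccode); projection.
apply: computable_rat_lt; first by projection.
apply: computable_rat_divS; last exact: computable_S.
by apply: computable_rat_divS => //; apply/computable_rat_nat/computable_nat.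
Qed.

Lemma maximal_semimeasure_gt0 (m : word -> Measures R -> \bar R) :
  maximal_uniform_semimeasure m -> forall x P, 0 < m x P.
Proof.
move=> [[_ m0 _] mm] x P.
have [m' /mm[c c0 m'm] m'0] := positive_semimeasure.
have := lt_le_trans (m'0 x P) (m'm x P).
by rewrite pmule_rgt0 // lte_fin.
Qed.

Variable m : word -> Measures R -> \bar R.
Hypothesis m_gt0 : forall x P, 0 < m x P.

Lemma mass_ratio_ge0 P x : 0 <= mass_ratio m P x.
Proof.
rewrite /mass_ratio; case: ifPn => // h.
by rewrite mule_ge0 ?inve_ge0 ?mass_ge0 // ltW.
Qed.

(** Equality fails only at mass [0], where [+oo * 0] is [0] while [m x P] is positive. *)
Lemma mass_ratioM P x : mass_ratio m P x * mass P x <= m x P.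
Proof.
rewrite /mass_ratio; case: eqP => [->|/eqP h]; first by rewrite mule0 ltW.
by rewrite -muleA [_^-1 * _]muleC divee ?mass_fin_num // mule1.
Qed.

(** Rational bounds on numerator and denominator certify the ratio. This covers mass [0] too:
    [m x P] is positive and [rv b] may be taken as small as desired. Negative [r] is separate
    because the ratio is nonnegative. *)
Lemma mass_ratio_gtP (r : R) P x : r%:E < mass_ratio m P x <->
  (r < 0)%R \/ exists a b, [/\ (rv a)%:E < m x P, mass P x < (rv b)%:E &
                               (r * rv b <= rv a)%R].
Proof.
have [p p0 pE] : exists2 p : R, (0 <= p)%R & mass P x = p%:E.
  exists (fine (mass P x)); first exact/fine_ge0/mass_ge0.
  by rewrite fineK // mass_fin_num.
have rP : (0 <= r)%R -> r%:E < mass_ratio m P x <-> (r * p)%:E < m x P.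
  move=> r0; rewrite /mass_ratio pE eqe; case: eqP => [->|/eqP pn0].
    by rewrite mulr0 ltry; split.
  have pp : (0 < p)%R by rewrite lt_neqAle eq_sym pn0.
  by rewrite inver (negbTE pn0) lte_pdivlMr.
case: (ltP r 0%R) => r0.
  split=> [_|_]; first by left.
  by apply: lt_le_trans (mass_ratio_ge0 P x); rewrite lte_fin.
rewrite rP //; split=> [h|[//|[a [b [am]]]]]; last first.
  rewrite pE lte_fin => pb rba; apply: le_lt_trans am; rewrite lee_fin.
  by apply: le_trans rba; rewrite ler_wpM2l // ltW.
right; have [a [ra am]] := rat_val_dense_ereal h.
have r1 : (0 < r + 1)%R by rewrite ltr_wpDl.
(* [r] times the allowed excess of [rv b] over [p] stays below [rv a - r * p]; the divisor [r + 1]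
   is positive even for [r = 0]. *)
have [b /andP[pb bq]] : exists b, (p < rv b < p + (rv a - r * p) / (r + 1))%R.
  by apply: rat_val_dense; rewrite ltrDl divr_gt0 // subr_gt0.
exists a, b; split=> //; first by rewrite pE lte_fin.
move: bq; rewrite -ltrBlDl ltr_pdivlMr // => bq.
have : (0 <= rv b - p)%R by rewrite subr_ge0 ltW.
nra.
Qed.

Hypothesis m_semi : uniform_semimeasure m.

Lemma effectively_open_mass_ratio : effectively_open
  (fun (p : DProd DRat DWord) P => (rv p.1)%:E < mass_ratio m P p.2).
Proof.
have [/lower_semicomputable_word om _ _] := m_semi.
apply: (effectively_open_ext (U := fun (p : DProd DRat DWord) P =>
  rat_lt p.1 (rat_nat 0) \/
  exists c : DProd DRat DRat, ((rv c.1)%:E < m p.2 P /\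
    mass P p.2 < (rv c.2)%:E) /\ rat_le (rat_mul p.1 c.2) c.1)).
  move=> [q x] P; rewrite mass_ratio_gtP (rat_val_lt R) rat_val_nat /=.
  split=> -[|h]; do ?[by left]; right.
    case: h => [[a b] /= [[am bm]]]; rewrite (rat_val_le R) rat_val_mul => h.
    by exists a, b.
  case: h => [a [b [am bm h]]]; exists (a, b); split=> //=.
  by rewrite (rat_val_le R) rat_val_mul.
apply: effectively_open_or.
  apply: effectively_open_computable; apply: computable_rat_lt.
    by projection.
  exact/computable_rat_nat/computable_nat.
pose D := DProd (DProd DRat DWord) (DProd DRat DRat).
apply: (@effectively_open_ex R (DProd DRat DWord) (DProd DRat DRat)
  (fun p P => ((rv p.2.1)%:E < m p.1.2 P /\
    mass P p.1.2 < (rv p.2.2)%:E) /\ rat_le (rat_mul p.1.1 p.2.2) p.2.1)).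
apply: effectively_open_and; first apply: effectively_open_and.
- apply: (effectively_open_preimage
    (f := fun p : D => (p.2.1, p.1.2) : DProd DRat DWord) _ om).
  by computability.
- by apply: (@effectively_open_mass_lt R D); projection.
- apply: effectively_open_computable; apply: computable_rat_le; last by projection.
  by apply: computable_rat_mul; projection.
Qed.

Lemma sum_gtP (a : nat -> \bar R) (n : nat) (q : R) : (forall i, 0 <= a i) ->
  q%:E < \sum_(0 <= i < n) a i <-> exists L : seq DRat,
    [/\ size L = n, (q < \sum_(u <- L) rv u)%R &
        forall i, (i < n)%N -> (rv (nth (rat_nat 0) L i))%:E < a i].
Proof.
move=> a0; split; last first.
  move=> [L [<- qL La]]; apply: (@lt_le_trans _ _ (\sum_(u <- L) rv u)%:E).
    by rewrite lte_fin.
  rewrite (big_nth (rat_nat 0)) -sumEFin big_nat_cond [leRHS]big_nat_cond.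
  by apply: lee_sum => i /andP[/andP[_ iL] _]; apply/ltW/La.
elim: n q => [|n IH] q.
  by rewrite big_geq // lte_fin => q0; exists [::]; rewrite big_nil.
rewrite big_nat_recr //= => h.
have s0 : 0 <= \sum_(0 <= i < n) a i by exact: sume_ge0.
(* A rational below the last term is split off so that the rest still exceeds [q - rv r]. If the
   rest is [+oo], any rational below the last term works, and one exists because that term exceeds
   [-1]. *)
have [r [ran qrs]] : exists r : DRat, (rv r)%:E < a n /\
    (q - rv r)%:E < \sum_(0 <= i < n) a i.
  move: h (a0 n) s0; move: (a n) (\sum_(0 <= i < n) a i) => x s.
  case: s => [s||//]; last first.
    move=> _ x0 _; have [|r [_ rx]] := @rat_val_dense_ereal R (-1)%R x.
      by apply: lt_le_trans x0; rewrite lte_fin oppr_lt0.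
    by exists r; rewrite ltry.
  move=> h x0 s0; have [|r [qr rx]] := @rat_val_dense_ereal R (q - s)%R x.
    by rewrite EFinB lteBlDr // addeC.
  by exists r; split=> //; rewrite lte_fin ltrBlDr -ltrBlDl.
have [L [sL qL La]] := IH _ qrs.
exists (rcons L r); split; first by rewrite size_rcons sL.
  by rewrite -cats1 big_cat big_seq1 /= -ltrBlDr.
move=> i; rewrite ltnS leq_eqVlt => /orP[/eqP ->|ni].
  by rewrite nth_rcons sL ltnn eqxx.
by rewrite nth_rcons sL ni La.
Qed.

Lemma prefix_sum_uniform_test : uniform_test (prefix_sum m).
Proof.
split=> [|w P|P]; last 2 first.
- by apply: esum_ge0 => x _; exact: mass_ratio_ge0.
- rewrite /prefix_sum integral_esum_prefix; last exact: mass_ratio_ge0.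
  have [_ _ m1] := m_semi; apply: le_trans (m1 P).
  by apply: le_esum => x _; exact: mass_ratioM.
(* [L] bounds the first [size L] terms from below. They belong to the prefixes of length at most
   [size L - 1], hence the bound [(size p.2).+1]. *)
pose V (p : DProd DRat DWord) P := exists L : DSeq DRat,
  (rat_lt p.1 (rat_sum L) && (size L <= (size p.2).+1)%N) /\
  forall i, (i < size L)%N ->
    (rv (nth (rat_nat 0) L i))%:E < mass_ratio m P (mkseq (nth false p.2) i).
apply: (@lower_semicomputable_Omega R _ V); last first.
  move=> q w P; rewrite /prefix_sum esum_prefix; last exact: mass_ratio_ge0.
  rewrite nneseries_gtP; last by move=> n; exact: mass_ratio_ge0.
  split=> [[n]|[x xw [L [/andP[/= qL Lx] La]]]].
    rewrite sum_gtP; last by move=> k; exact: mass_ratio_ge0.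
    move=> [L [sL qL La]].
    have pw : prefix_of (mkseq w n) w by apply/prefix_ofE; rewrite size_mkseq.
    exists (mkseq w n) => //; exists L; split.
      by rewrite (rat_val_lt R) rat_val_sum qL /= size_mkseq sL leqnSn.
    move=> i; rewrite sL => iL /=; rewrite (mkseq_prefix_of pw) ?La //.
    by rewrite size_mkseq ltnW.
  exists (size L); apply/sum_gtP; first by move=> k; exact: mass_ratio_ge0.
  exists L; split=> //; first by rewrite -rat_val_sum -(rat_val_lt R).
  move=> i iL; rewrite -(mkseq_prefix_of xw) ?La //.
  by rewrite -ltnS (leq_trans iL).
pose D := DProd (DProd DRat DWord) (DSeq DRat).
apply: (@effectively_open_ex R (DProd DRat DWord) (DSeq DRat) (fun p P =>
  (rat_lt p.1.1 (rat_sum p.2) && (size p.2 <= (size p.1.2).+1)%N) /\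
  forall i, (i < size p.2)%N ->
   (rv (nth (rat_nat 0) p.2 i))%:E < mass_ratio m P (mkseq (nth false p.1.2) i))).
have cs : @computable D DNat (fun p => size p.2).
  by apply: (@computable_size D DRat); projection.
apply: effectively_open_and.
  apply: effectively_open_computable; apply: computable_andb.
    apply: computable_rat_lt; first by projection.
    by apply: computable_rat_sum; projection.
  apply: computable_leq => //; apply: computable_S.
  by apply: (@computable_size D DBool); projection.
apply: (@effectively_open_all_lt R D (fun p => size p.2) (fun p P =>
  (rv (nth (rat_nat 0) p.1.2 p.2))%:E <
  mass_ratio m P (mkseq (nth false p.1.1.2) p.2))) => //.
apply: (effectively_open_preimage (f := fun p : DProd D DNat =>
  (nth (rat_nat 0) p.1.2 p.2, mkseq (nth false p.1.1.2) p.2) : DProd DRat DWord)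
  _ effectively_open_mass_ratio).
apply: computable_pair; first by apply: (@computable_nth _ DRat); projection.
apply: (@computable_mkseq (DProd D DNat) DBool (fun p => p.2)
  (fun p => nth false p.1.1.1.2 p.2)); first by projection.
by apply: (@computable_nth _ DBool); projection.
Qed.

End PrefixSumTest.

Lemma List_In_nth (T : Type) (x0 : T) (s : seq T) (x : T) :
  List.In x s <-> exists2 i, (i < size s)%N & nth x0 s i = x.
Proof.
elim: s => [|y s IH]; first by split=> // -[].
split=> [[->|/IH[i si ix]]|[[|i] si ix]].
- by exists 0%N.
- by exists i.+1.
- by left.
- by right; apply/IH; exists i.
Qed.

(** * Continuous approximations of a uniform test *)

Section Stages.
Variable R : realType.
Local Notation rv := (rat_val R).
Local Notation Measures := (Measures R).
Implicit Types P : Measures.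

(** The signed slack of the mass inside its interval, scaled by [k.+1]: when the condition holds it
    tends to infinity with [k] and eventually stops constraining a minimum. *)
Definition margin (k : nat) P (c : DCond) : R :=
  k.+1%:R * Num.min (fine (mass P c.2) - rv c.1.1) (rv c.1.2 - fine (mass P c.2)).

Lemma margin_gtE k P c (r : R) : (r < margin k P c) =
  (((rv c.1.1 + r / k.+1%:R)%:E < mass P c.2)%E &&
   (mass P c.2 < (rv c.1.2 - r / k.+1%:R)%:E)%E).
Proof.
rewrite -(fineK (mass_fin_num P c.2)) !lte_fin /margin.
rewrite -[X in (X < _) = _](@divfK _ k.+1%:R) ?pnatr_eq0 // mulrC.
rewrite ltr_pM2l ?ltr0Sn // lt_min; congr andb.
  by rewrite ltrBrDl.
by rewrite ltrBrDl ltrBrDr addrC.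
Qed.

Lemma margin_ltE k P c (r : R) : (margin k P c < r) =
  ((mass P c.2 < (rv c.1.1 + r / k.+1%:R)%:E)%E ||
   ((rv c.1.2 - r / k.+1%:R)%:E < mass P c.2)%E).
Proof.
rewrite -(fineK (mass_fin_num P c.2)) !lte_fin /margin.
rewrite -[X in (_ < X) = _](@divfK _ k.+1%:R) ?pnatr_eq0 // [X in (_ < X) = _]mulrC.
rewrite ltr_pM2l ?ltr0Sn // gt_min; congr orb.
  by rewrite ltrBlDl.
by rewrite ltrBlDl ltrBlDr addrC.
Qed.

Lemma margin_gt0P k P c : reflect (cond_holds P c) (0 < margin k P c).
Proof.
by rewrite margin_gtE mul0r addr0 subr0; apply: (iffP andP).
Qed.

(** A negative slack would decrease with [k], but [stage] cuts off at [0] and only positive values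
    matter. *)
Lemma margin_le k j P c : (k <= j)%N -> 0 < margin k P c ->
  margin k P c <= margin j P c.
Proof.
rewrite /margin => kj; rewrite pmulr_rgt0 // => h.
by rewrite ler_pM2r // ler_nat.
Qed.

Lemma effectively_open_margin_gt (A : dtype) (k : A -> DNat) (c : A -> DCond)
    (r : A -> DRat) : computable k -> computable c -> computable r ->
  effectively_open (fun a P => rv (r a) < margin (k a) P (c a)).
Proof.
move=> ck cc cr.
apply: (effectively_open_ext (U := fun (a : A) P =>
  ((rv (rat_add (c a).1.1 (rat_divS (r a) (k a))))%:E < mass P (c a).2)%E /\
  (mass P (c a).2 <
    (rv (rat_add (c a).1.2 (rat_opp (rat_divS (r a) (k a)))))%:E)%E)).
  move=> a P; rewrite margin_gtE !rat_val_add rat_val_opp rat_val_divS.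
  by split=> [[-> ->]|/andP[]].
have cd := computable_rat_divS cr ck.
apply: effectively_open_and.
  apply: effectively_open_mass_gt; first by computability.
  by apply: computable_rat_add => //; computability.
apply: effectively_open_mass_lt; first by computability.
by apply: computable_rat_add; [computability|exact: computable_rat_opp].
Qed.

Lemma effectively_open_margin_lt (A : dtype) (k : A -> DNat) (c : A -> DCond)
    (r : A -> DRat) : computable k -> computable c -> computable r ->
  effectively_open (fun a P => margin (k a) P (c a) < rv (r a)).
Proof.
move=> ck cc cr.
apply: (effectively_open_ext (U := fun (a : A) P =>
  (mass P (c a).2 < (rv (rat_add (c a).1.1 (rat_divS (r a) (k a))))%:E)%E \/
  ((rv (rat_add (c a).1.2 (rat_opp (rat_divS (r a) (k a)))))%:E <
    mass P (c a).2)%E)).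
  move=> a P; rewrite margin_ltE !rat_val_add rat_val_opp rat_val_divS.
  by split=> [/orP|/orP].
have cd := computable_rat_divS cr ck.
apply: effectively_open_or.
  apply: effectively_open_mass_lt; first by computability.
  by apply: computable_rat_add => //; computability.
apply: effectively_open_mass_gt; first by computability.
by apply: computable_rat_add; [computability|exact: computable_rat_opp].
Qed.

Variable e : DNat -> DProd DRat DBasic.
Hypothesis ce : computable e.

Local Notation level n := (rv (e n).1).
Local Notation stem n := ((e n).2.1 : seq bool).
Local Notation conds n := ((e n).2.2 : seq DCond).
Local Notation cond0 := (dval_default DCond).

Definition prefixb (x : word) (w : nat -> bool) : bool :=
  all (fun i => w i == nth false x i) (iota 0 (size x)).

Lemma prefixP x w : reflect (prefix_of x w) (prefixb x w).
Proof.
apply: (iffP allP) => [h i ix|h i].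
  by apply/eqP/h; rewrite mem_iota.
by rewrite mem_iota => /andP[_ ix]; apply/eqP/h.
Qed.

Definition height n k P : R :=
  \big[Num.min/level n]_(i < size (conds n)) margin k P (nth cond0 (conds n) i).

(* As [k] grows, [max 0 (height n k P)] increases to [max 0 (level n)] if [P] lies
   in the basic set of measures named by [e n] and stays [0] otherwise, so [stage]
   increases to the function that [e] enumerates. *)
Definition stage k (w : nat -> bool) P : R :=
  \big[Num.max/0]_(n < k | (size (stem n) <= k)%N && prefixb (stem n) w)
    height n k P.

Lemma height_gtP n k P (r : R) : r < height n k P <->
  r < level n /\
  forall i, (i < size (conds n))%N -> r < margin k P (nth cond0 (conds n) i).
Proof.
split=> [/bigmin_gtP[rl rm]|[rl rm]].
  by split=> // i ic; exact: (rm (Ordinal ic)).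
by apply/bigmin_gtP; split=> // i _; exact: rm.
Qed.

Lemma height_ltP n k P (r : R) : height n k P < r <->
  level n < r \/
  exists2 i, (i < size (conds n))%N & margin k P (nth cond0 (conds n) i) < r.
Proof.
split=> [/bigmin_ltP[rl|[i _ rm]]|h]; first by left.
  by right; exists (val i); [exact: ltn_ord|exact: rm].
apply/bigmin_ltP; case: h => [rl|[i ic rm]]; first by left.
by right; exists (Ordinal ic).
Qed.

Lemma stage_gtP k w P (r : R) : r < stage k w P <->
  r < 0 \/ exists2 n, (n < k)%N &
    ((size (stem n) <= k)%N && prefixb (stem n) w) /\ r < height n k P.
Proof.
split=> [/bigmax_gtP[|[n nw rh]]|h]; first by left.
  by right; exists (val n); [exact: ltn_ord|split].
apply/bigmax_gtP; case: h => [|[n nk [nw rh]]]; first by left.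
by right; exists (Ordinal nk).
Qed.

Lemma stage_ltP k w P (r : R) : stage k w P < r <->
  0 < r /\ forall n, (n < k)%N ->
    ~~ ((size (stem n) <= k)%N && prefixb (stem n) w) \/ height n k P < r.
Proof.
split=> [/bigmax_ltP[r0 h]|[r0 h]].
  split=> // n nk; case: (boolP (_ && _)) => nw; last by left.
  by right; exact: (h (Ordinal nk)).
apply/bigmax_ltP; split=> // n nw.
by case: (h n (ltn_ord n)) => //; rewrite nw.
Qed.

Lemma stage_ge0 k w P : 0 <= stage k w P.
Proof. exact: bigmax_ge_id. Qed.

Lemma stage0 w P : stage 0 w P = 0.
Proof. by rewrite /stage big_ord0. Qed.

Lemma stage_ext k w w' P : (forall i, (i < k)%N -> w i = w' i) ->
  stage k w P = stage k w' P.
Proof.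
move=> ww; apply: eq_bigl => n; case: leqP => //= nk.
apply: eq_in_all => i; rewrite mem_iota => /andP[_ ix].
by rewrite ww // (leq_trans ix).
Qed.

Lemma stage_le k j w P : (k <= j)%N -> stage k w P <= stage j w P.
Proof.
move=> kj; rewrite leNgt; apply/negP => /stage_gtP[|].
  by apply/negP; rewrite -leNgt stage_ge0.
move=> [n nk [/andP[nw nx] h]].
suff : height n k P <= stage j w P by rewrite leNgt h.
apply: (@le_trans _ _ (height n j P)).
  rewrite leNgt; apply/negP => /height_ltP.
  have h0 : 0 < height n k P by apply: le_lt_trans h; exact: stage_ge0.
  case=> [lh|[i ic mh]].
    suff : height n k P <= level n by rewrite leNgt lh.
    exact: bigmin_le_id.
  have m0 : 0 < margin k P (nth cond0 (conds n) i).
    by have /height_gtP[_] := h0; apply.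
  suff : height n k P <= margin k P (nth cond0 (conds n) i).
    by rewrite leNgt (le_lt_trans (margin_le kj m0) mh).
  exact: (bigmin_le_cond _ (j := Ordinal ic)).
rewrite leNgt; apply/negP => /stage_ltP[_ /(_ n (leq_trans nk kj))].
by rewrite (leq_trans nw kj) nx /= ltxx => -[].
Qed.

Lemma effectively_open_height_gt (A : dtype) (n k : A -> DNat) (r : A -> DRat) :
  computable n -> computable k -> computable r ->
  effectively_open (fun a P => rv (r a) < height (n a) (k a) P).
Proof.
move=> cn ck cr; have cen := computable_comp ce cn.
apply: (effectively_open_ext (U := fun (a : A) P => rat_lt (r a) (e (n a)).1 /\
  forall i, (i < size (conds (n a)))%N ->
    rv (r a) < margin (k a) P (nth cond0 (conds (n a)) i))).
  by move=> a P; rewrite height_gtP (rat_val_lt R).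
apply: effectively_open_and.
  by apply: effectively_open_computable; apply: computable_rat_lt; computability.
apply: (@effectively_open_all_lt R A (fun a => size (conds (n a))) (fun p P =>
  rv (r p.1) < margin (k p.1) P (nth cond0 (conds (n p.1)) p.2))).
  by apply: (@computable_size _ DCond); computability.
have cf := computable_fst A DNat.
apply: effectively_open_margin_gt.
- exact: (computable_comp ck).
- apply: computable_nth; last by projection.
  by have cep := computable_comp cen cf; computability.
- exact: (computable_comp cr).
Qed.

Lemma effectively_open_height_lt (A : dtype) (n k : A -> DNat) (r : A -> DRat) :
  computable n -> computable k -> computable r ->
  effectively_open (fun a P => height (n a) (k a) P < rv (r a)).
Proof.
move=> cn ck cr; have cen := computable_comp ce cn.
apply: (effectively_open_ext (U := fun (a : A) P => rat_lt (e (n a)).1 (r a) \/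
  exists2 i, (i < size (conds (n a)))%N &
    margin (k a) P (nth cond0 (conds (n a)) i) < rv (r a))).
  by move=> a P; rewrite height_ltP (rat_val_lt R).
apply: effectively_open_or.
  by apply: effectively_open_computable; apply: computable_rat_lt; computability.
apply: (@effectively_open_ex_lt R A (fun a => size (conds (n a))) (fun p P =>
  margin (k p.1) P (nth cond0 (conds (n p.1)) p.2) < rv (r p.1))).
  by apply: (@computable_size _ DCond); computability.
have cf := computable_fst A DNat.
apply: effectively_open_margin_lt.
- exact: (computable_comp ck).
- apply: computable_nth; last by projection.
  by have cep := computable_comp cen cf; computability.
- exact: (computable_comp cr).
Qed.

Lemma computable_active (A : dtype) (n k : A -> DNat) (x : A -> DWord) :
  computable n -> computable k -> computable x ->
  @computable A DBool (fun a => (size (stem (n a)) <= k a)%N &&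
    prefixb (stem (n a)) (nth false (x a))).
Proof.
move=> cn ck cx; have cen := computable_comp ce cn.
have cs : @computable A DNat (fun a => size (stem (n a))).
  by apply: (@computable_size _ DBool); computability.
apply: computable_andb; first exact: computable_leq.
apply: (@computable_all_iota A (fun a => size (stem (n a))) (fun p =>
  nth false (x p.1) p.2 == nth false (stem (n p.1)) p.2)) => //.
have cf := computable_fst A DNat.
have cep := computable_comp cen cf; have cxp := computable_comp cx cf.
have c1 : @computable (DProd A DNat) DBool (fun p => nth false (x p.1) p.2).
  by apply: (@computable_nth _ DBool); computability.
have c2 : @computable (DProd A DNat) DBool (fun p => nth false (stem (n p.1)) p.2).
  by apply: (@computable_nth _ DBool); computability.
apply: (computable_ext _ (computable_if c1 c2 (computable_negb c2))) => p.
by case: (nth false (x p.1) p.2); case: (nth false _ _).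
Qed.

Lemma effectively_open_stage_gt (A : dtype) (k : A -> DNat) (x : A -> DWord)
    (r : A -> DRat) : computable k -> computable x -> computable r ->
  effectively_open (fun a P => rv (r a) < stage (k a) (nth false (x a)) P).
Proof.
move=> ck cx cr.
apply: (effectively_open_ext (U := fun (a : A) P => rat_lt (r a) (rat_nat 0) \/
  exists2 n, (n < k a)%N &
    ((size (stem n) <= k a)%N && prefixb (stem n) (nth false (x a))) /\
    rv (r a) < height n (k a) P)).
  by move=> a P; rewrite stage_gtP (rat_val_lt R) rat_val_nat.
apply: effectively_open_or.
  apply: effectively_open_computable; apply: computable_rat_lt => //.
  exact/computable_rat_nat/computable_nat.
apply: (@effectively_open_ex_lt R A k (fun p P =>
  ((size (stem p.2) <= k p.1)%N && prefixb (stem p.2) (nth false (x p.1))) /\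
    rv (r p.1) < height p.2 (k p.1) P)) => //.
have cf := computable_fst A DNat; have cs := computable_snd A DNat.
have ckp := computable_comp ck cf.
apply: effectively_open_and.
  apply: effectively_open_computable; apply: computable_active => //.
  exact: (computable_comp cx).
by apply: effectively_open_height_gt => //; exact: (computable_comp cr).
Qed.

(** An increment subtracts one stage from another, so bounding it from below also requires upper
    bounds on stages. *)
Lemma effectively_open_stage_lt (A : dtype) (k : A -> DNat) (x : A -> DWord)
    (r : A -> DRat) : computable k -> computable x -> computable r ->
  effectively_open (fun a P => stage (k a) (nth false (x a)) P < rv (r a)).
Proof.
move=> ck cx cr.
apply: (effectively_open_ext (U := fun (a : A) P => rat_lt (rat_nat 0) (r a) /\
  forall n, (n < k a)%N ->
    ~~ ((size (stem n) <= k a)%N && prefixb (stem n) (nth false (x a))) \/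
    height n (k a) P < rv (r a))).
  by move=> a P; rewrite stage_ltP (rat_val_lt R) rat_val_nat.
apply: effectively_open_and.
  apply: effectively_open_computable; apply: computable_rat_lt => //.
  exact/computable_rat_nat/computable_nat.
apply: (@effectively_open_all_lt R A k (fun p P =>
  ~~ ((size (stem p.2) <= k p.1)%N && prefixb (stem p.2) (nth false (x p.1))) \/
    height p.2 (k p.1) P < rv (r p.1))) => //.
have cf := computable_fst A DNat; have cs := computable_snd A DNat.
have ckp := computable_comp ck cf.
apply: effectively_open_or.
  apply: effectively_open_computable; apply: computable_negb.
  by apply: computable_active => //; exact: (computable_comp cx).
by apply: effectively_open_height_lt => //; exact: (computable_comp cr).
Qed.

(** * Increments of the stages and the semimeasure they define *)

Definition increment (x : word) P : R :=
  stage (size x) (nth false x) P - stage (size x).-1 (nth false x) P.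

Lemma increment_ge0 x P : 0 <= increment x P.
Proof. by rewrite subr_ge0 stage_le ?leq_pred. Qed.

Lemma increment_mkseq w k P :
  increment (mkseq w k) P = stage k w P - stage k.-1 w P.
Proof.
rewrite /increment size_mkseq; congr (_ - _); apply: stage_ext => i ik.
  by rewrite nth_mkseq.
by rewrite nth_mkseq // (leq_trans ik) ?leq_pred.
Qed.

(** Telescoping. The term [i = 0] vanishes because [0.-1] is [0], so [n] terms reach only
    [stage n.-1]. *)
Lemma sum_increment w n P :
  (\sum_(0 <= i < n) (increment (mkseq w i) P)%:E = (stage n.-1 w P)%:E)%E.
Proof.
elim: n => [|n IH]; first by rewrite big_geq // stage0.
by rewrite big_nat_recr //= IH increment_mkseq -EFinD addrC subrK.
Qed.

Definition increment_mass (x : word) P : \bar R :=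
  ((increment x P)%:E * mass P x)%E.

(** [rv a - rv b] and [rv c] are nonnegative lower bounds for the increment and the mass, so their
    product bounds [increment_mass] from below; a negative [q] needs no certificate. *)
Lemma increment_mass_gtP x P (q : R) : (q%:E < increment_mass x P)%E <->
  q < 0 \/ exists a b c, [/\ rv a < stage (size x) (nth false x) P,
    stage (size x).-1 (nth false x) P < rv b, ((rv c)%:E < mass P x)%E &
    [/\ 0 <= rv c, rv b <= rv a & q <= (rv a - rv b) * rv c]].
Proof.
have [p p0 pE] : exists2 p : R, 0 <= p & mass P x = p%:E.
  exists (fine (mass P x)); first exact/fine_ge0/mass_ge0.
  by rewrite fineK // mass_fin_num.
rewrite /increment_mass pE -EFinM lte_fin.
have f0 := increment_ge0 x P.
case: (ltP q 0) => q0.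
  by split=> [_|_]; [left|apply: lt_le_trans q0 _; exact: mulr_ge0].
move: f0; rewrite /increment.
move: (stage _ _ _) (stage _.-1 _ _) => T T' f0.
split=> [h|[//|[a [b [c [aT bT]]]]]]; last first.
  rewrite lte_fin => cp [c0 ba qc]; apply: (le_lt_trans qc).
  nra.
right.
have f1 : 0 < T - T'.
  by rewrite lt_neqAle f0 andbT eq_sym; apply: contraTneq h => ->; rewrite mul0r -leNgt.
have [c /andP[qc cp]] : exists c, q / (T - T') < rv c < p.
  by apply: rat_val_dense; rewrite ltr_pdivrMr // mulrC.
have c0 : 0 < rv c by apply: le_lt_trans qc; rewrite divr_ge0.
(* Half of the room between [T - T'] and [q / rv c]: with [rv a] within [d] of [T] and [rv b] within
   [d] of [T'], the difference still exceeds [q / rv c]. *)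
have d0 : 0 < (T - T' - q / rv c) / 2.
  by rewrite divr_gt0 // subr_gt0 ltr_pdivrMr // mulrC -ltr_pdivrMr.
move: d0; set d := _ / 2 => d0.
have dE : 2 * d = T - T' - q / rv c by rewrite /d mulrC divfK.
have [a /andP[aT aT']] : exists a, T - d < rv a < T.
  by apply: rat_val_dense; rewrite ltrBlDr ltrDl.
have [b /andP[bT bT']] : exists b, T' < rv b < T' + d.
  by apply: rat_val_dense; rewrite ltrDl.
have qc0 : 0 <= q / rv c by rewrite divr_ge0 // ltW.
exists a, b, c; split=> //; split; [exact: ltW|lra|].
by rewrite -ler_pdivrMr //; lra.
Qed.

Lemma lower_semicomputable_increment_mass :
  lower_semicomputable (fun x => [set x]) increment_mass.
Proof.
apply/lower_semicomputable_word.
pose B := DProd DRat DWord; pose D := DProd DRat (DProd DRat DRat).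
apply: (effectively_open_ext (U := fun (p : B) P =>
  rat_lt p.1 (rat_nat 0) \/ exists d : D,
  ((rv d.1 < stage (size p.2) (nth false p.2) P /\
    stage (size p.2).-1 (nth false p.2) P < rv d.2.1) /\
   ((rv d.2.2)%:E < mass P p.2)%E) /\
   ((rat_le (rat_nat 0) d.2.2 && rat_le d.2.1 d.1) &&
    rat_le p.1 (rat_mul (rat_add d.1 (rat_opp d.2.1)) d.2.2)))).
  move=> [q x] P; rewrite increment_mass_gtP (rat_val_lt R) rat_val_nat /=.
  split=> -[|h]; do ?[by left]; right.
    case: h => [[a [b c]] /= [[[aT bT] cp]]].
    rewrite !(rat_val_le R) rat_val_nat rat_val_mul rat_val_add rat_val_opp.
    by move=> /andP[/andP[c0 ba] qc]; exists a, b, c.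
  case: h => [a [b [c [aT bT cp [c0 ba qc]]]]]; exists (a, (b, c)); split=> //=.
  rewrite !(rat_val_le R) rat_val_nat rat_val_mul rat_val_add rat_val_opp.
  by rewrite c0 ba qc.
have c0 (A : dtype) : computable (fun _ : A => rat_nat 0).
  exact/computable_rat_nat/computable_nat.
apply: effectively_open_or.
  by apply: effectively_open_computable; apply: computable_rat_lt; computability.
apply: (@effectively_open_ex R B D (fun p P =>
  ((rv p.2.1 < stage (size p.1.2) (nth false p.1.2) P /\
    stage (size p.1.2).-1 (nth false p.1.2) P < rv p.2.2.1) /\
   ((rv p.2.2.2)%:E < mass P p.1.2)%E) /\
   ((rat_le (rat_nat 0) p.2.2.2 && rat_le p.2.2.1 p.2.1) &&
    rat_le p.1.1 (rat_mul (rat_add p.2.1 (rat_opp p.2.2.1)) p.2.2.2)))).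
have cs : @computable (DProd B D) DNat (fun p => size p.1.2).
  by apply: (@computable_size _ DBool); projection.
apply: effectively_open_and; first apply: effectively_open_and;
  first apply: effectively_open_and.
- by apply: (@effectively_open_stage_gt (DProd B D) (fun p => size p.1.2)) => //;
    projection.
- apply: (@effectively_open_stage_lt (DProd B D) (fun p => (size p.1.2).-1));
    by [exact: computable_pred|projection].
- by apply: (@effectively_open_mass_gt R (DProd B D)); projection.
- apply: effectively_open_computable; apply: computable_andb.
    apply: computable_andb; apply: computable_rat_le; by [exact: c0|projection].
  apply: computable_rat_le; first by projection.
  apply: computable_rat_mul; last by projection.
  apply: computable_rat_add; first by projection.
  by apply: computable_rat_opp; projection.
Qed.

Variable t : Omega -> Measures -> \bar R.
Hypothesis t_ge0 : forall w P, (0 <= t w P)%E.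
Hypothesis t_int : forall P, (\int[P]_w t w P <= 1)%E.
Hypothesis tE : forall q : DRat,
  [set z : Omega * Measures | ((rv q)%:E < t z.1 z.2)%E] =
  \bigcup_(b in [set b : DBasic | range e (q, b)])
    (cylinder b.1 `*` basic_measures b.2).

Lemma stage_supremum w P (q : R) :
  (q%:E < t w P)%E <-> exists k, q < stage k w P.
Proof.
have tP (u : DRat) : ((rv u)%:E < t w P)%E <-> exists2 n, (e n).1 = u &
    prefix_of (stem n) w /\ basic_measures (conds n) P.
  have := tE u; rewrite predeqE => /(_ (w, P)) /= ->.
  split=> [[b [n _ enb] [bw bP]]|[n <- [nw nP]]].
    by exists n; rewrite enb.
  by exists (e n).2 => //; exists n => //; case: (e n).
case: (ltP q 0) => q0.
  split=> _; first by exists 0%N; rewrite stage0.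
  by apply: lt_le_trans (t_ge0 w P); rewrite lte_fin.
split=> [/rat_val_dense_ereal[u [qu /tP[n nu [nw nP]]]]|[k]]; last first.
  move=> /stage_gtP[|[n nk [/andP[_ /prefixP nw] /height_gtP[ql qm]]]].
    by rewrite ltNge q0.
  apply: (@lt_trans _ _ (level n)%:E); first by rewrite lte_fin.
  apply/tP; exists n => //; split=> // c /(List_In_nth cond0)[i si <-].
  by apply/(margin_gt0P k); apply: le_lt_trans (qm _ si).
(* The least unscaled margin, capped at [1] so that it is defined and positive even without
   conditions. *)
pose g := \big[Num.min/1]_(i < size (conds n)) margin 0 P (nth cond0 (conds n) i).
have g0 : 0 < g.
  apply/bigmin_gtP; split=> // i _; apply/margin_gt0P/nP/(List_In_nth cond0).
  by exists (val i) => //; exact: ltn_ord.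
(* Large enough to reach index [n], to admit its stem, and to make [k.+1%:R * g] exceed [q]. *)
pose k := (n + size (stem n) + Num.bound (q / g)).+1.
exists k; apply/stage_gtP; right; exists n; first by rewrite /k -addnA -addnS; lia.
split.
  by apply/andP; split; [rewrite /k; lia|exact/prefixP].
apply/height_gtP; split=> [|i si]; first by rewrite nu.
have gm : g <= margin 0 P (nth cond0 (conds n) i).
  exact: (bigmin_le_cond _ (j := Ordinal si)).
have mk : margin k P (nth cond0 (conds n) i) =
    k.+1%:R * margin 0 P (nth cond0 (conds n) i) by rewrite /margin mul1r.
rewrite mk; apply: (@lt_le_trans _ _ (k.+1%:R * g)); last by rewrite ler_pM2l.
rewrite -ltr_pdivrMr //.
have qg0 : 0 <= q / g by rewrite divr_ge0 // ltW.
apply: (lt_le_trans (archi_boundP qg0)); rewrite ler_nat /k; lia.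
Qed.

(** Both sides exceed the same reals: the partial sums of the increments are stages, and
    [stage_supremum] says the same of [t]. *)
Lemma test_eq_esum_increment w P :
  t w P = \esum_(x in [set x : word | prefix_of x w]) (increment x P)%:E.
Proof.
have i0 x : (0 <= (increment x P)%:E)%E by rewrite lee_fin increment_ge0.
have cut (q : R) : (q%:E < t w P)%E <-> (q%:E <
    \esum_(x in [set x : word | prefix_of x w]) (increment x P)%:E)%E.
  rewrite esum_prefix // nneseries_gtP // stage_supremum.
  split=> [[k h]|[n]]; first by exists k.+1; rewrite sum_increment lte_fin.
  by rewrite sum_increment lte_fin; exists n.-1.
have s0 : (0 <= \esum_(x in [set x : word | prefix_of x w]) (increment x P)%:E)%E.
  exact: esum_ge0.
have asym (x y : \bar R) : (0 <= x)%E ->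
    (forall q : R, (q%:E < y)%E -> (q%:E < x)%E) -> (y <= x)%E.
  case: x => [x| |//] _ h; last by rewrite leey.
  by rewrite leNgt; apply/negP => /h; rewrite ltxx.
by apply/eqP; rewrite eq_le; apply/andP; split; apply: asym => // q /cut.
Qed.

Lemma increment_mass_uniform_semimeasure : uniform_semimeasure increment_mass.
Proof.
split=> [|x P|P]; first exact: lower_semicomputable_increment_mass.
  by rewrite mule_ge0 ?mass_ge0 // lee_fin increment_ge0.
rewrite -(@integral_esum_prefix R P (fun x => (increment x P)%:E)); last first.
  by move=> x; rewrite lee_fin increment_ge0.
apply: le_trans (t_int P); rewrite le_eqVlt; apply/orP; left; apply/eqP.
by apply: eq_integral => w _; rewrite test_eq_esum_increment.
Qed.

(** Term by term the mass cancels where it is positive; at mass [0] the ratio is [+oo] by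
    convention. *)
Lemma test_le_prefix_sum w P : (t w P <= prefix_sum increment_mass w P)%E.
Proof.
rewrite test_eq_esum_increment; apply: le_esum => x _.
rewrite /mass_ratio; case: eqP => [_|/eqP x0]; first by rewrite leey.
by rewrite /increment_mass -muleA divee ?mass_fin_num // mule1.
Qed.

End Stages.

(** * Comparison of uniform tests with prefix sums *)

Lemma uniform_test_le_prefix_sum (R : realType)
    (t : Omega -> Measures R -> \bar R) : uniform_test t ->
  exists2 m : word -> Measures R -> \bar R, uniform_semimeasure m &
    forall w P, (t w P <= prefix_sum m w P)%E.
Proof.
move=> [[S [S0|[e ce eS]] SP] t0 t1]; last first.
  have tE (q : DRat) : [set z : Omega * Measures R | ((rat_val R q)%:E < t z.1 z.2)%E] =
      \bigcup_(b in [set b : DBasic | range e (q, b)])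
      (cylinder b.1 `*` basic_measures b.2) by rewrite SP eS.
  exists (@increment_mass R e).
    exact: (increment_mass_uniform_semimeasure ce t0 t1 tE).
  by move=> w P; exact: (test_le_prefix_sum t0 tE).
(* An empty enumeration is contradictory, since a nonnegative test exceeds [-1] everywhere. The
   contradiction needs a point [(w, P)], so some semimeasure is supplied first. *)
have [m mP _] := positive_semimeasure R; exists m => // w P; exfalso.
have := SP (rat_opp (rat_nat 1)); rewrite predeqE => /(_ (w, P)) /= [+ _].
rewrite S0 => h; case: h => [|b []].
apply: lt_le_trans (t0 w P); rewrite lte_fin rat_val_opp rat_val_nat.
by rewrite oppr_lt0.
Qed.

(** Term by term: at mass [0] both ratios are [+oo], and a positive [c] preserves this value. *)
Lemma prefix_sum_le (R : realType) (m m' : word -> Measures R -> \bar R) (c : R) :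
  0 < c -> (forall x P, 0 <= m x P)%E ->
  (forall x P, m' x P <= c%:E * m x P)%E ->
  forall w P, (prefix_sum m' w P <= c%:E * prefix_sum m w P)%E.
Proof.
move=> c0 m0 m'm w P.
have r0 x : (0 <= mass_ratio m P x)%E.
  by rewrite /mass_ratio; case: ifPn => // _; rewrite mule_ge0 ?inve_ge0 ?mass_ge0.
rewrite /prefix_sum [in leRHS]esum_prefix // -nneseriesZl //.
rewrite -(@esum_prefix R w (fun x => c%:E * mass_ratio m P x)%E); last first.
  by move=> x; rewrite mule_ge0 // lee_fin ltW.
apply: le_esum => x _; rewrite /mass_ratio; case: ifPn => _.
  by rewrite gt0_muley ?lte_fin.
by rewrite muleA lee_wpmul2r ?inve_ge0 ?mass_ge0.
Qed.

Theorem theorem14 (R : realType)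
    (t : Omega -> Measures R -> \bar R) (m : word -> Measures R -> \bar R)
    (ht : universal_uniform_test t) (hm : maximal_uniform_semimeasure m) :
  exists c1 c2 : R, 0 < c1 /\ 0 < c2 /\
    forall (w : Omega) (P : Measures R),
      (c1%:E * prefix_sum m w P <= t w P)%E /\
      (t w P <= c2%:E * prefix_sum m w P)%E.
Proof.
have m_gt0 := maximal_semimeasure_gt0 hm.
have [t_test t_max] := ht; have [m_semi m_max] := hm.
have [c c0 st] := t_max _ (prefix_sum_uniform_test m_gt0 m_semi).
have [m' m'_semi tm'] := uniform_test_le_prefix_sum t_test.
have [c' c'0 m'm] := m_max _ m'_semi.
(* [c] bounds the prefix sum by the test, hence its inverse in the lower bound; [c'] bounds the
   semimeasure extracted from [t] by [m]. *)
exists c^-1, c'; split; first by rewrite invr_gt0.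
split=> // w P; split; first by rewrite lee_pdivrMl.
apply: le_trans (tm' w P) _; apply: prefix_sum_le => //.
by move=> x Q; exact: ltW.
Qed.
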